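(* Let $G$ be a compact connected Lie group with Lie algebra $\mathfrak g$ of dimension $n$ and bi-invariant Riemannian metric $\langle\cdot,\cdot\rangle$, let $\{A_1,\dots,A_n\}$ be an orthonormal basis of $\mathfrak g$, and let $\eta\in\mathfrak g^*$ with coadjoint orbit $\mathcal O_\eta$. Define functions on $\mathcal O_\eta\times\mathfrak g\times\mathfrak g^*$ by $$l_1(\theta,Y,\xi)=\theta(Y)+\tfrac12\xi(X_\xi),\qquad l_{i+1}(\theta,Y,\xi)=(\theta+\mathrm{ad}^*_Y\xi)(A_i),\quad i=1,\dots,n.$$ If $G$ is semisimple, then $\{l_j\}_{j=1,\dots,n+1}$ is a set of functionally independent functions on an open dense subset of $\mathcal O_\eta\times\mathfrak g\times\mathfrak g^*$.
   Context: $\mathrm{Ad}^*_x\xi=\xi\circ\mathrm{Ad}_x$, $\mathrm{ad}_YZ=[Y,Z]$, $\mathrm{ad}^*_Y\xi=\xi\circ\mathrm{ad}_Y$ for $\xi\in\mathfrak g^*$. $X_\xi\in\mathfrak g$ is defined by $\xi(Y)=\langle X_\xi,Y\rangle$ for all $Y\in\mathfrak g$. $\mathcal O_\eta=\{\mathrm{Ad}^*_x\eta:x\in G\}\subset\mathfrak g^*$. Functions are functionally independent on an open set if their differentials are linearly independent at every point of it, i.e. $dl_1\wedge\cdots\wedge dl_{n+1}\neq0$ there. *)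

(* Defs.v *)
From HB Require Import structures.
From mathcomp Require Import all_boot all_order all_algebra.
From mathcomp Require Import all_classical all_reals.
From mathcomp Require Import topology normedtype derive.

Set Implicit Arguments.
Unset Strict Implicit.
Unset Printing Implicit Defensive.
Import Order.TTheory GRing.Theory Num.Theory.
Import numFieldNormedType.Exports.
Local Open Scope classical_set_scope.
Local Open Scope ring_scope.

(* C^k and C^oo on an open set [A]; the domains below are finite-dimensional, so
   C^k-regularity of the differential is that of all directional derivatives. *)
Fixpoint Ck_on (R : realType) (V W : normedModType R) (k : nat) (A : set V)
    (f : V -> W) : Prop :=
  if k is k'.+1 then
    (forall x, A x -> differentiable f x) /\
    (forall v, Ck_on k' A (fun x => 'D_v f x))
  else forall x, A x -> {for x, continuous f}.

Definition smooth_on (R : realType) (V W : normedModType R) (A : set V)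
    (f : V -> W) : Prop := forall k, Ck_on k A f.

(* A chart is a homeomorphism from the open set [csource] onto an open subset of
   R^n; the values of [cto] and [cfrom] off [csource] and [ctarget] are junk. *)
Record chart (R : realType) (n : nat) (M : topologicalType) := Chart {
  csource : set M;
  cto :> M -> 'rV[R]_n;
  cfrom : 'rV[R]_n -> M;
  ctarget := cto @` csource;
  csource_open : open csource;
  ctarget_open : open ctarget;
  ctoK : forall x, csource x -> cfrom (cto x) = x;
  cto_continuous : forall x, csource x -> {for x, continuous cto};
  cfrom_continuous : forall p, ctarget p -> {for p, continuous cfrom}
}.

(* Smooth manifolds of dimension [n]. [chart_at] selects a preferred chart around
   each point; T_xM is represented by 'rV[R]_n through the chart [chart_at x]. *)
HB.mixin Record isSmoothManifold (R : realType) (n : nat) M of Topological M := {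
  manifold_hausdorff : hausdorff_space M;
  manifold_second_countable : @second_countable M;
  atlas : set (chart R n M);
  chart_at : M -> chart R n M;
  chart_at_atlas : forall x, atlas (chart_at x);
  mem_chart_at : forall x, csource (chart_at x) x;
  atlas_smooth : forall c d, atlas c -> atlas d ->
    smooth_on (c @` (csource c `&` csource d)) (d \o cfrom c)
}.

#[short(type="smoothManifoldType")]
HB.structure Definition SmoothManifold (R : realType) (n : nat) :=
  {M of isSmoothManifold R n M & Topological M}.

Arguments atlas {R n s}.
Arguments chart_at {R n s} x.

Definition smooth_map (R : realType) (m n : nat) (M : smoothManifoldType R m)
    (N : smoothManifoldType R n) (f : M -> N) : Prop :=
  continuous f /\
  forall (c : chart R m M) (d : chart R n N), atlas c -> atlas d ->
    smooth_on (c @` (csource c `&` f @^-1` csource d)) (d \o f \o cfrom c).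

(* Smoothness of a map M x M -> M, in the product charts. *)
Definition smooth_map2 (R : realType) (n : nat) (M : smoothManifoldType R n)
    (f : M -> M -> M) : Prop :=
  continuous (fun z : M * M => f z.1 z.2) /\
  forall c1 c2 d : chart R n M, atlas c1 -> atlas c2 -> atlas d ->
    smooth_on
      [set p : 'rV[R]_n * 'rV[R]_n |
        [/\ ctarget c1 p.1, ctarget c2 p.2
          & csource d (f (cfrom c1 p.1) (cfrom c2 p.2))]]
      (fun p => d (f (cfrom c1 p.1) (cfrom c2 p.2))).

HB.mixin Record isLieGroup (R : realType) (n : nat) G
    of SmoothManifold R n G & Group G := {
  lie_mul_smooth : @smooth_map2 R n G (fun x y : G => (x * y)%g);
  lie_inv_smooth : @smooth_map R n n G G (fun x : G => (x^-1)%g)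
}.

#[short(type="lieGroupType")]
HB.structure Definition LieGroup (R : realType) (n : nat) :=
  {G of isLieGroup R n G & SmoothManifold R n G & Group G}.

(* The tangent map T_xM -> T_(f x)N, in the preferred charts at x and f x. *)
Definition tmap (R : realType) (m n : nat) (M : smoothManifoldType R m)
    (N : smoothManifoldType R n) (f : M -> N) (x : M) (v : 'rV[R]_m) : 'rV[R]_n :=
  'd (chart_at (f x) \o f \o cfrom (chart_at x)) (chart_at x x) v.

(* [g x] is the inner product on T_xM. *)
Record riemannian_metric (R : realType) (n : nat) (M : smoothManifoldType R n)
    (g : M -> 'rV[R]_n -> 'rV[R]_n -> R) : Prop := RiemannianMetric {
  metric_linear : forall x (a : R) u v w,
    g x (a *: u + v) w = a * g x u w + g x v w;
  metric_sym : forall x u v, g x u v = g x v u;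
  metric_pos : forall x u, u != 0 -> 0 < g x u u;
  metric_smooth : forall (c : chart R n M) (u v : 'rV[R]_n), atlas c ->
    smooth_on (ctarget c) (fun p => g (cfrom c p)
      ('d (chart_at (cfrom c p) \o cfrom c) p u)
      ('d (chart_at (cfrom c p) \o cfrom c) p v) : R^o)
}.

Section LieGroupTheory.
Context (R : realType) (n : nat) (G : lieGroupType R n).

Definition biinvariant_metric (g : G -> 'rV[R]_n -> 'rV[R]_n -> R) : Prop :=
  [/\ riemannian_metric g,
      forall x y u v,
        g (x * y)%g (tmap (fun z : G => (x * z)%g) y u)
                    (tmap (fun z : G => (x * z)%g) y v) = g y u v
    & forall x y u v,
        g (y * x)%g (tmap (fun z : G => (z * x)%g) y u)
                    (tmap (fun z : G => (z * x)%g) y v) = g y u v].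

(* The Lie algebra is T_1G. [left_invariant Y] is the coordinate expression, in
   the preferred chart at 1, of the left-invariant vector field with value Y at 1,
   and [lie_bracket Y Z] is the value at 1 of the commutator of two such fields. *)
Definition left_invariant (Y : 'rV[R]_n) (p : 'rV[R]_n) : 'rV[R]_n :=
  let phi := chart_at (1%g : G) in
  'd (fun q => phi (cfrom phi p * cfrom phi q)%g) (phi 1%g) Y.

Definition lie_bracket (Y Z : 'rV[R]_n) : 'rV[R]_n :=
  let e := chart_at (1%g : G) 1%g in
  'D_Y (left_invariant Z) e - 'D_Z (left_invariant Y) e.

Definition lie_ad (Y Z : 'rV[R]_n) : 'rV[R]_n := lie_bracket Y Z.

Definition lie_Ad (x : G) : 'rV[R]_n -> 'rV[R]_n :=
  tmap (fun y : G => (x * y * x^-1)%g) 1%g.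

Definition lie_ideal (I : {vspace 'rV[R]_n}) : Prop :=
  forall Y Z, Z \in I -> lie_bracket Y Z \in I.

Definition lie_derived (I : {vspace 'rV[R]_n}) : {vspace 'rV[R]_n} :=
  <<[seq lie_bracket Y Z | Y <- vbasis I, Z <- vbasis I]>>%VS.

Definition lie_solvable (I : {vspace 'rV[R]_n}) : Prop :=
  exists k, iter k lie_derived I = 0%VS.

Definition semisimple : Prop :=
  forall I, lie_ideal I -> lie_solvable I -> I = 0%VS.

(* The dual of the Lie algebra is the space of column vectors, [xi] acting by
   [coapp xi]; [covec f] is the element of the dual given by a linear form f. *)
Definition coapp (xi : 'cV[R]_n) (Y : 'rV[R]_n) : R := (Y *m xi) 0 0.

Definition covec (f : 'rV[R]_n -> R) : 'cV[R]_n := \col_i f (delta_mx 0 i).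

Lemma covecK (f : {linear 'rV[R]_n -> R^o}) Y : coapp (covec f) Y = f Y.
Proof.
rewrite /coapp mxE {2}(row_sum_delta Y) linear_sum; apply: eq_bigr => i _.
by rewrite mxE linearZ.
Qed.

Definition coAd (x : G) (xi : 'cV[R]_n) : 'cV[R]_n :=
  covec (coapp xi \o lie_Ad x).

Definition coad (Y : 'rV[R]_n) (xi : 'cV[R]_n) : 'cV[R]_n :=
  covec (coapp xi \o lie_ad Y).

Definition coadjoint_orbit (eta : 'cV[R]_n) : set 'cV[R]_n :=
  [set coAd x eta | x in [set: G]].

Definition orthonormal_basis (g : G -> 'rV[R]_n -> 'rV[R]_n -> R)
    (A : 'I_n -> 'rV[R]_n) : Prop :=
  basis_of {:'rV[R]_n} [seq A i | i <- enum 'I_n] /\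
  forall i j, g 1%g (A i) (A j) = (i == j)%:R.

Definition riesz (g : G -> 'rV[R]_n -> 'rV[R]_n -> R) (xi : 'cV[R]_n) : 'rV[R]_n :=
  xget 0 [set X | forall Y, coapp xi Y = g 1%g X Y].

(* [ell g A ord0] is l_1, and [ell g A (lift ord0 i)] is
   (theta + ad^*_Y xi)(A_i). *)
Definition ell (g : G -> 'rV[R]_n -> 'rV[R]_n -> R) (A : 'I_n -> 'rV[R]_n)
    (j : 'I_n.+1) (p : 'cV[R]_n * 'rV[R]_n * 'cV[R]_n) : R^o :=
  let: (theta, Y, xi) := p in
  if unlift ord0 j is Some i then coapp (theta + coad Y xi) (A i)
  else coapp theta Y + 2^-1 * coapp xi (riesz g xi).

End LieGroupTheory.

Arguments semisimple {R n} G.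
Arguments coadjoint_orbit {R n} G eta.

(* Tangent vectors at p to an embedded submanifold S of a finite-dimensional
   space: velocities of smooth curves lying in S. *)
Definition tangent_vectors (R : realType) (V : normedModType R) (S : set V)
    (p : V) : set V :=
  [set v | exists gamma : R^o -> V,
     [/\ smooth_on [set: R^o] gamma, forall t, S (gamma t), gamma 0 = p
       & 'D_1 gamma 0 = v]].

(* The functions [f j] are defined on the ambient space; the differential at p of
   the restriction of [f j] to S is the restriction of ['d (f j) p] to T_pS. *)
Definition functionally_independent_on (R : realType) (V : normedModType R)
    (m : nat) (S : set V) (f : 'I_m -> V -> R^o) (U : set V) : Prop :=
  forall p, U p -> forall a : 'I_m -> R,
    (forall v, tangent_vectors S p v -> \sum_(j < m) a j * 'd (f j) p v = 0) ->
    forall j, a j = 0.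

Definition open_dense_in (T : topologicalType) (S U : set T) : Prop :=
  (exists2 O, open O & U = S `&` O) /\ S `<=` closure U.

(* Main.v *)
(* Testing a linear relation between the differentials of the l_j at (theta, Y, xi)
   against the tangent vectors (0, Z, 0) and (0, 0, zeta) only, with coefficient a0
   of l_1 and W the combination of the A_i with the other coefficients, gives
     a0 X_xi + [Y, W] = 0   and   a0 theta(Z) + <X_xi, [Z, W]> = 0 for all Z.
   Pairing the first identity with Y kills the bracket by invariance, so a0 = 0
   where xi(Y) <> 0; then W commutes with Y and X_xi. The relation is therefore
   trivial on the set where xi(Y) <> 0 and Y, X_xi have no common centralizer.
   This set contains the nonvanishing locus of a polynomial in (Y, xi), which is
   open, and dense as soon as it is nonempty; no information on the orbit is needed.

   For nonemptiness take a pair (Y, X) at which the rank of V |-> ([Y, V], [X, V])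
   is maximal and W in its kernel. First-order perturbation shows that for all Y', X'
   there is V with [Y, V] = [Y', W] and [X, V] = [X', W]. Choosing Y' = 0, X' = Z,
   invariance makes V orthogonal to the image of ad_W, so [W, V] = 0, and the Jacobi
   identity gives [W, [Z, W]] = [W, [X, V]] = 0, whence [Z, W] = 0. So W is central,
   hence zero by semisimplicity.

   The Jacobi identity and the invariance of the inner product come from
   differentiating, in the preferred chart at 1, the associativity law and the
   left and right invariance of the metric. *)

Require Import Defs.
From HB Require Import structures.
From mathcomp Require Import all_boot all_order all_algebra.
From mathcomp Require Import all_classical all_reals.
From mathcomp Require Import topology normedtype landau derive.
From mathcomp Require Import ring.
Import Order.TTheory GRing.Theory Num.Theory.
Import numFieldNormedType.Exports.
Local Open Scope classical_set_scope.
Local Open Scope ring_scope.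

(** * Calculus *)

Section Reparametrization.
Context {R : realType} {U V W : normedModType R}.

(** A directional derivative sees only the restriction to a line, so both difference quotients
    coincide as functions of [h]. This moves derivatives to slices of products, translates and
    polynomials in one real variable. *)
Lemma is_derive_along (f : U -> W) (g : V -> W) x v y w d :
  (forall h : R, f (h *: v + x) = g (h *: w + y)) ->
  is_derive y w g d -> is_derive x v f d.
Proof.
move=> fg [gd gv].
have E : (fun h : R => h^-1 *: ((f \o shift x) (h *: v) - f x)) =
    (fun h => h^-1 *: ((g \o shift y) (h *: w) - g y)).
  apply/funext => h /=; rewrite fg; congr (_ *: (_ - _)).
  by have := fg 0; rewrite !scale0r !add0r.
by split; [rewrite /derivable E | rewrite /derive E].
Qed.

Lemma derive_along (f : U -> W) (g : V -> W) x v y w :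
  (forall h : R, f (h *: v + x) = g (h *: w + y)) -> 'D_v f x = 'D_w g y.
Proof.
move=> fg; rewrite /derive.
have -> : (fun h : R => h^-1 *: ((f \o shift x) (h *: v) - f x)) =
    (fun h => h^-1 *: ((g \o shift y) (h *: w) - g y)) => //.
apply/funext => h /=; rewrite fg; congr (_ *: (_ - _)).
by have := fg 0; rewrite !scale0r !add0r.
Qed.

End Reparametrization.

Section ProductRules.
Context {R : realType} {V W : normedModType R}.

Lemma is_derive_scale (f : V -> R) (g : V -> W) x v (df : R) (dg : W) :
  is_derive x v f df -> is_derive x v g dg ->
  is_derive x v (fun y => f y *: g y) (f x *: dg + df *: g x).
Proof.
move=> [fd <-] [gd <-].
suff H : (fun h => h^-1 *: (((fun y => f y *: g y) \o shift x) (h *: v)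
    - f x *: g x)) @ 0^' --> f x *: 'D_v g x + 'D_v f x *: g x.
  by apply: DeriveDef; [apply/cvg_ex; eexists; exact: H | exact: cvg_lim].
pose q h := h^-1 *: ((g \o shift x) (h *: v) - g x).
pose r (h : R) : R := h^-1 *: ((f \o shift x) (h *: v) - f x).
have -> : (fun h => h^-1 *: (((fun y => f y *: g y) \o shift x) (h *: v)
    - f x *: g x)) = (fun h => f (h *: v + x) *: q h + r h *: g x).
  apply/funext => h; rewrite /q /r /= scalerA mulrC -scalerA -scalerA -scalerDr.
  by congr (_ *: _); rewrite scalerBr scalerBl addrA subrK.
apply: cvgD; apply: cvgZ; [|exact: gd|exact: fd|exact: cvg_cst].
(* Derivability along [v] gives continuity of [f] along the line through [x] only, which is all that
   the factor [f (h *: v + x)] requires. *)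
have /derivable1P/derivable1_diffP/differentiable_continuous := fd.
move=> fc; have -> : f x = f (0 *: v + x) by rewrite scale0r add0r.
apply: cvg_trans fc; exact/cvg_app/cvg_within.
Qed.

(** A Leibniz rule: expanding [B y (u y)] over the standard basis gives a finite sum of coordinates
    of [u] times values of [B y] at fixed vectors, to which the product rule applies. *)
Lemma is_derive_linear_family n (B : V -> 'rV[R]_n -> W) (B' : 'rV[R]_n -> W)
    (u : V -> 'rV[R]_n) du x v :
  (\forall y \near x, linear (B y)) -> linear B' ->
  (forall z, is_derive x v (B^~ z) (B' z)) -> is_derive x v u du ->
  is_derive x v (fun y => B y (u y)) (B' (u x) + B x du).
Proof.
move=> Blin B'lin Bder uder.
have expand (L : 'rV[R]_n -> W) z :
    linear L -> L z = \sum_i z 0 i *: L (delta_mx 0 i).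
  move=> Llin; pose lL := GRing.isLinear.Build _ _ _ _ L Llin.
  pose L' : {linear 'rV[R]_n -> W} := HB.pack L lL.
  rewrite -[L]/(L' : _ -> _) {1}(row_sum_delta z) linear_sum.
  by apply: eq_bigr => i _; rewrite linearZ.
have coordd i : is_derive x v (fun y => u y 0 i) (du 0 i).
  case: uder => ud <-; apply: DeriveDef; last by rewrite derive_mx // mxE.
  exact: (derivable_mxP _ _ _).1.
apply: (near_eq_is_derive
  (f := \sum_(i < n) (fun y => u y 0 i *: B y (delta_mx 0 i)))).
  near=> y; rewrite fct_sumE expand //.
  by near: y.
rewrite [B' _]expand // [B x _]expand; last exact: nbhs_singleton Blin.
rewrite [X in is_derive _ _ _ X]addrC -big_split /=.
apply: is_derive_sum => i; rewrite addrC; exact: is_derive_scale.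
Unshelve. all: by end_near. Qed.

End ProductRules.

(** * Symmetry of second derivatives *)

Section Schwarz.
Context {R : realType} {V : normedModType R}.

Lemma line_is_derive (W : normedModType R) (f : V -> W) (y v : V) (t : R) :
  differentiable f (y + t *: v) ->
  is_derive t 1 (fun s => f (y + s *: v)) ('D_v f (y + t *: v)).
Proof.
move=> /(@diff_derivable _ _ _ _ _ v) /derivableP; apply: is_derive_along => h.
by rewrite [h *: 1]mulr1 scalerDl addrCA.
Qed.

Lemma MVT_line (f : V -> R) (y v : V) (h : R) : 0 < h ->
  (forall t, 0 <= t <= h -> differentiable f (y + t *: v)) ->
  exists2 c, 0 < c < h & f (y + h *: v) - f y = h * 'D_v f (y + c *: v).
Proof.
move=> h0 fd; have [||c] := @MVT _ (fun s => f (y + s *: v))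
    (fun s => 'D_v f (y + s *: v)) 0 h h0.
- move=> t; rewrite in_itv /= => /andP[t0 th].
  by apply/line_is_derive/fd; rewrite !ltW.
- apply: derivable_within_continuous => t; rewrite in_itv /= => tI.
  by case: (line_is_derive _ _ _ _ _ (fd t tI)).
- by rewrite in_itv /= scale0r addr0 subr0 mulrC => cI E; exists c.
Qed.

(** Two groupings of the same four corner values force [p' = q'], so [p] and [q] are both within
    [e / 2] of one number. *)
Let second_difference (a b c d p q p' q' h e : R) : 0 < h ->
  `|p - p'| < e / 2 -> `|q - q'| < e / 2 ->
  a - b - (c - d) = h * (h * p') -> a - c - (b - d) = h * (h * q') ->
  `|p - q| <= e.
Proof.
move=> /lt0r_neq0 h0 pe qe E1 E2.
have p'q' : p' = q'.
  by apply: (mulfI h0); apply: (mulfI h0); rewrite -E1 -E2; ring.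
rewrite -(subrK p' p) -addrA (splitr e) ltW //.
by rewrite (le_lt_trans (ler_normD _ _)) // ltrD // p'q' distrC.
Qed.

(* Both mixed derivatives are limits of the second difference of [f] divided by
   [h ^ 2], by two applications of the mean value theorem. *)
Lemma derive_comm_real (f : V -> R) (x v w : V) :
  (\forall y \near x, differentiable f y) ->
  (\forall y \near x, differentiable ('D_v f) y) ->
  (\forall y \near x, differentiable ('D_w f) y) ->
  {for x, continuous ('D_w ('D_v f))} -> {for x, continuous ('D_v ('D_w f))} ->
  'D_w ('D_v f) x = 'D_v ('D_w f) x.
Proof.
move=> fd fvd fwd cwv cvw; apply/eqP; rewrite -subr_eq0 -normr_le0.
apply/ler_addgt0Pr => eps eps0; rewrite add0r.
have e2 : 0 < eps / 2 by rewrite divr_gt0.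
have main (u u' : V) : (\forall y \near x, differentiable f y) ->
    (\forall y \near x, differentiable ('D_u f) y) ->
    {for x, continuous ('D_u' ('D_u f))} ->
  \forall h \near (0 : R)^'+, exists2 z : V,
    `|'D_u' ('D_u f) x - 'D_u' ('D_u f) z| < eps / 2 &
    f (x + h *: u + h *: u') - f (x + h *: u) - (f (x + h *: u') - f x) =
    h * (h * 'D_u' ('D_u f) z).
  move=> gd gud /cvgrPdist_lt /(_ _ e2) gc.
  have /nbhs_ballP[r /= r0 rP] : \forall y \near x, [/\ differentiable f y,
      differentiable ('D_u f) y & `|'D_u' ('D_u f) x - 'D_u' ('D_u f) y| < eps / 2].
    by near=> y; split; near: y.
  have [d d0 dP] : exists2 d : R, 0 < d & forall s t : R, 0 <= s <= d ->
      0 <= t <= d -> ball x r (x + s *: u + t *: u').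
    (* The added 1 keeps [k] positive when both directions vanish, and halving [r] makes the final
       inequality strict. *)
    pose k := `|u| + `|u'| + 1.
    have k0 : 0 < k by rewrite ltr_wpDl // addr_ge0.
    exists (r / 2 / k) => [|s t /andP[s0 sd] /andP[t0 td]].
      by rewrite !divr_gt0.
    rewrite -ball_normE /ball_ /= -addrA opprD addNKr normrN.
    apply: (@le_lt_trans _ _ (r / 2)); last first.
      by rewrite ltr_pdivrMr // ltr_pMr // ltr1n.
    apply: (le_trans (ler_normD _ _)); rewrite !normrZ !ger0_norm //.
    apply: (@le_trans _ _ (r / 2 / k * (`|u| + `|u'|))).
      by rewrite mulrDr lerD // ler_wpM2r.
    rewrite -mulrA ler_piMr //; first by rewrite divr_ge0 // ltW.
    by rewrite ler_pdivrMl // mulr1 lerDl.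
  near=> h.
  have h0 : 0 < h by near: h; exact: nbhs_right_gt.
  have hd : h <= d by near: h; exact: nbhs_right_le.
  (* The first mean value theorem, along [u], is applied to the increment of [f] in direction [u'];
     the second, along [u'], to ['D_u f]. *)
  pose F y := f (y + h *: u') - f y.
  have Fd t : 0 <= t <= h -> differentiable F (x + t *: u).
    move=> /andP[t0 th]; apply: (@differentiableB _ _ _ (fun y => f (y + h *: u'))).
      apply: (@differentiable_comp _ _ _ _ (fun y => y + h *: u')).
        exact: differentiableD.
      by have [] := rP _ (dP t h _ _); rewrite ?t0 ?(le_trans th) ?(ltW h0).
    have [] := rP _ (dP t 0 _ _); rewrite ?t0 ?(le_trans th) ?lexx ?(ltW d0) //.
    by rewrite scale0r addr0.
  have [c /andP[c0 ch] cE] := MVT_line _ _ _ _ h0 Fd.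
  have DF : 'D_u F (x + c *: u) =
      'D_u f (x + c *: u + h *: u') - 'D_u f (x + c *: u).
    have d1 : differentiable f (x + c *: u + h *: u').
      have [] // := rP _ (dP c h _ _); rewrite ?(ltW c0) ?(ltW h0) //=.
      exact: le_trans (ltW ch) hd.
    have d2 : differentiable f (x + c *: u).
      have [] := rP _ (dP c 0 _ _);
        rewrite ?(ltW c0) ?lexx ?(ltW d0) ?(le_trans (ltW ch) hd) //=.
      by rewrite scale0r addr0.
    have d3 : derivable (fun y => f (y + h *: u')) (x + c *: u) u.
      apply: diff_derivable; apply: (@differentiable_comp _ _ _ _ (fun y => y + h *: u')).
        exact: differentiableD.
      exact: d1.
    have -> : 'D_u f (x + c *: u + h *: u') =
        'D_u (fun y => f (y + h *: u')) (x + c *: u).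
      by apply: derive_along => s; rewrite -!addrA.
    exact: (deriveB d3 (@diff_derivable _ _ _ _ _ u d2)).
  have [|c' /andP[c'0 c'h] c'E] := MVT_line ('D_u f) (x + c *: u) u' h h0.
    move=> t /andP[t0 th]; have [] // := rP _ (dP c t _ _);
      by rewrite ?(ltW c0) ?t0 //= (le_trans _ hd) // ltW.
  exists (x + c *: u + c' *: u').
    have [] // := rP _ (dP c c' _ _); rewrite ?(ltW c0) ?(ltW c'0) //=;
    by rewrite (le_trans _ hd) // ltW.
  by rewrite -c'E -DF -cE.
have [h [h0 [z1 z1e E1] [z2 z2e E2]]] : exists h : R, [/\ 0 < h,
    exists2 z : V, `|'D_w ('D_v f) x - 'D_w ('D_v f) z| < eps / 2 &
    f (x + h *: v + h *: w) - f (x + h *: v) - (f (x + h *: w) - f x) =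
    h * (h * 'D_w ('D_v f) z) &
    exists2 z : V, `|'D_v ('D_w f) x - 'D_v ('D_w f) z| < eps / 2 &
    f (x + h *: w + h *: v) - f (x + h *: w) - (f (x + h *: v) - f x) =
    h * (h * 'D_v ('D_w f) z)].
  have M1 := main v w fd fvd cwv; have M2 := main w v fd fwd cvw.
  have M0 : \forall h \near (0 : R)^'+, 0 < h by exact: nbhs_right_gt.
  have [h [h0 [h1 h2]]] := filter_ex (filterI M0 (filterI M1 M2)).
  exists h; split; [exact: h0 | exact: h1 | exact: h2].
rewrite (addrAC x (h *: w)) in E2; exact: (second_difference _ _ _ _ _ _ _ _ _ _ h0 z1e z2e E1 E2).
Unshelve. all: by end_near. Qed.

Lemma near_eq_differentiable (W : normedModType R) (f g : V -> W) x :
  (\forall y \near x, f y = g y) -> differentiable f x -> differentiable g x.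
Proof.
move=> fg fd; have [dc de] := (diff_locallyP _ _).1 fd.
have gx : g \o shift x = cst (g x) + 'd f x +o_ (0 : V) id.
  apply/eqaddoP => e e0.
  move: de => /eqaddoP /(_ e e0).
  have : \forall y \near (0 : V), f (y + x) = g (y + x).
    by move: fg; rewrite (near_shift 0 x) /=; apply: filterS => y; rewrite subr0.
  rewrite -(nbhs_singleton fg); apply: filterS2 => y /= E.
  by rewrite -![(_ + _ : _ -> _) _]/(_ + _) -![(- _ : _ -> _) _]/(- _) /= E.
by apply/diff_locallyP; rewrite (diff_unique dc gx).
Qed.

Lemma smooth_on_differentiable (W : normedModType R) (A : set V) (f : V -> W) x :
  smooth_on A f -> A x -> differentiable f x.
Proof. by move=> fs Ax; have [+ _] := fs 1; apply. Qed.

Lemma smooth_on_derive (W : normedModType R) (A : set V) (f : V -> W) v :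
  smooth_on A f -> smooth_on A ('D_v f).
Proof. by move=> fs k; have [_ fk] := fs k.+1; exact: fk. Qed.

Lemma derive_row_entry n (f : V -> 'rV[R]_n) x v i :
  differentiable f x -> 'D_v (fun y => f y 0 i) x = 'D_v f x 0 i.
Proof. by move=> fd; rewrite derive_mx ?mxE //; exact: diff_derivable. Qed.

(** The scalar case is applied to each coordinate. Coordinates commute with derivatives on [A],
    which is a neighbourhood of [x], and derivatives depend only on germs. *)
Lemma derive_comm n (A : set V) (f : V -> 'rV[R]_n) x v w :
  open A -> smooth_on A f -> A x -> 'D_w ('D_v f) x = 'D_v ('D_w f) x.
Proof.
move=> Aop fs Ax; apply/rowP => i.
have Anx : \forall y \near x, A y by apply: open_nbhs_nbhs.
pose c (g : V -> 'rV[R]_n) y : R := g y 0 i.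
have cd g y : differentiable g y -> differentiable (c g) y.
  move=> gd; apply: (@differentiable_comp _ _ _ _ g (fun N : 'rV[R]_n => N 0 i : R)) => //.
  exact: differentiable_coord.
have sd g y : smooth_on A g -> A y -> differentiable g y.
  exact: smooth_on_differentiable.
have cD g u y : smooth_on A g -> A y -> 'D_u (c g) y = c ('D_u g) y.
  by move=> gs Ay; apply: derive_row_entry; exact: sd.
have cD2 u u' y : A y -> 'D_u ('D_u' (c f)) y = c ('D_u ('D_u' f)) y.
  move=> Ay; rewrite -cD //; last exact: smooth_on_derive.
  apply: near_eq_derive; have : \forall z \near y, A z by apply: open_nbhs_nbhs.
  by apply: filterS => z Az; rewrite cD.
have dD u : \forall y \near x, differentiable ('D_u (c f)) y.
  apply: filterS Anx => y Ay; apply: (near_eq_differentiable _ (c ('D_u f))).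
    have : \forall z \near y, A z by apply: open_nbhs_nbhs.
    by apply: filterS => z Az; rewrite cD.
  by apply: cd; apply: sd => //; exact: smooth_on_derive.
have cc u u' : {for x, continuous ('D_u ('D_u' (c f)))}.
  have gs : smooth_on A ('D_u ('D_u' f)) by do 2!apply: smooth_on_derive.
  apply: differentiable_continuous.
  apply: (near_eq_differentiable _ (c ('D_u ('D_u' f)))).
    by apply: filterS Anx => y Ay; rewrite cD2.
  by apply: cd; exact: (sd _ _ _ gs).
rewrite -[LHS](cD2 w v x Ax) -[RHS](cD2 v w x Ax).
have cfd : \forall y \near x, differentiable (c f) y.
  by apply: filterS Anx => y Ay; apply/cd/(sd _ _ _ fs).
exact: (derive_comm_real _ _ _ _ cfd (dD v) (dD w) (cc w v) (cc v w)).
Qed.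

End Schwarz.

(** * Local groups *)

Lemma linear_subE (R : pzRingType) (U W : lmodType R) (f : U -> W) :
  linear f -> forall u v, f (u - v) = f u - f v.
Proof. by move=> fl u v; rewrite addrC -scaleN1r fl scaleN1r addrC. Qed.

(* Locked so that unification does not unfold them to limits. *)
HB.lock Definition pderl {R : realType} {V1 V2 W : normedModType R} (v : V1)
  (F : V1 * V2 -> W) (x : V1 * V2) : W := 'D_((v, 0) : V1 * V2) F x.
HB.lock Definition pderr {R : realType} {V1 V2 W : normedModType R} (v : V2)
  (F : V1 * V2 -> W) (x : V1 * V2) : W := 'D_((0, v) : V1 * V2) F x.

(** * Partial derivatives on a product space *)

Section LinearDerivatives.
Context {R : realType}.

Lemma derive_comp (U V W : normedModType R) (f : U -> V) (g : V -> W) x v :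
  differentiable f x -> differentiable g (f x) ->
  'D_v (g \o f) x = 'D_('D_v f x) g (f x).
Proof.
move=> fd gd; rewrite !deriveE //; last exact: differentiable_comp.
by rewrite diff_comp.
Qed.

Lemma derive_linear (V W : normedModType R) (f : V -> W) x :
  differentiable f x -> linear (fun v => 'D_v f x).
Proof. by move=> fd a u v; rewrite !deriveE // linearP. Qed.

Context {V1 V2 W : normedModType R}.
Implicit Types (F : V1 * V2 -> W).

Lemma pderlE v F : pderl v F = 'D_((v, 0) : V1 * V2) F.
Proof. by rewrite unlock. Qed.

Lemma pderrE v F : pderr v F = 'D_((0, v) : V1 * V2) F.
Proof. by rewrite unlock. Qed.

Lemma smooth_on_pderl A F v : smooth_on A F -> smooth_on A (pderl v F).
Proof. by rewrite pderlE; exact: smooth_on_derive. Qed.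

Lemma smooth_on_pderr A F v : smooth_on A F -> smooth_on A (pderr v F).
Proof. by rewrite pderrE; exact: smooth_on_derive. Qed.

Lemma derive_slicel F p q v :
  'D_v (fun p' => F (p', q)) p = pderl v F (p, q).
Proof.
rewrite pderlE; apply: derive_along => h.
rewrite -[_ + (p, q)]/((h *: v + p, h *: 0 + q)).
by rewrite scaler0 add0r.
Qed.

Lemma derive_slicer F p q v :
  'D_v (fun q' => F (p, q')) q = pderr v F (p, q).
Proof.
rewrite pderrE; apply: derive_along => h.
rewrite -[_ + (p, q)]/((h *: 0 + p, h *: v + q)).
by rewrite scaler0 add0r.
Qed.

Lemma differentiable_slicel F p q :
  differentiable F (p, q) -> differentiable (fun p' => F (p', q)) p.
Proof.
by move=> Fd; apply: (@differentiable_comp _ _ _ _ (fun p' => (p', q))).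
Qed.

Lemma differentiable_slicer F p q :
  differentiable F (p, q) -> differentiable (fun q' => F (p, q')) q.
Proof.
by move=> Fd; apply: (@differentiable_comp _ _ _ _ (fun q' => (p, q'))).
Qed.

Lemma is_derive_slicel F p q v : differentiable F (p, q) ->
  is_derive p v (fun p' => F (p', q)) (pderl v F (p, q)).
Proof.
move=> /differentiable_slicel Fd; rewrite -derive_slicel.
exact/derivableP/diff_derivable.
Qed.

Lemma is_derive_slicer F p q v : differentiable F (p, q) ->
  is_derive q v (fun q' => F (p, q')) (pderr v F (p, q)).
Proof.
move=> /differentiable_slicer Fd; rewrite -derive_slicer.
exact/derivableP/diff_derivable.
Qed.

Lemma derive_linearl F p q : differentiable F (p, q) ->
  linear (fun v => pderl v F (p, q)).
Proof.
move=> /differentiable_slicel /derive_linear Fl a u v; rewrite -!derive_slicel.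
exact: Fl.
Qed.

Lemma derive_linearr  F p q : differentiable F (p, q) ->
  linear (fun v => pderr v F (p, q)).
Proof.
move=> /differentiable_slicer /derive_linear Fl a u v; rewrite -!derive_slicer.
exact: Fl.
Qed.

Lemma open_near_slicel (A : set (V1 * V2)) p q :
  open A -> A (p, q) -> \forall r \near p, A (r, q).
Proof.
move=> Aop Apq; have : nbhs (p, q) A by apply: open_nbhs_nbhs.
have : {for p, continuous (fun r : V1 => (r, q))}.
  exact: differentiable_continuous.
exact.
Qed.

Lemma open_near_slicer (A : set (V1 * V2)) p q :
  open A -> A (p, q) -> \forall r \near q, A (p, r).
Proof.
move=> Aop Apq; have : nbhs (p, q) A by apply: open_nbhs_nbhs.
have : {for q, continuous (fun r : V2 => (p, r))}.
  exact: differentiable_continuous.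
exact.
Qed.

End LinearDerivatives.

Section PartialDerivativesCommute.
Context {R : realType} {V1 V2 : normedModType R} {n : nat}.
Context (A : set (V1 * V2)) (F : V1 * V2 -> 'rV[R]_n) (x : V1 * V2).
Context (A_open : open A) (F_smooth : smooth_on A F) (Ax : A x).

Lemma pderlr_comm u v : pderl u (pderr v F) x = pderr v (pderl u F) x.
Proof. by rewrite !(pderlE, pderrE); exact: (derive_comm _ A). Qed.

Lemma pderll_comm u v : pderl u (pderl v F) x = pderl v (pderl u F) x.
Proof. by rewrite !(pderlE, pderrE); exact: (derive_comm _ A). Qed.

Lemma pderrr_comm u v : pderr u (pderr v F) x = pderr v (pderr u F) x.
Proof. by rewrite !(pderlE, pderrE); exact: (derive_comm _ A). Qed.

End PartialDerivativesCommute.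

(** * The bracket of a local group: Jacobi identity and invariance *)

Section LocalGroup.
Context {R : realType} {n : nat}.
Local Notation V := 'rV[R]_n.
Context (T : set V) (Om : set (V * V)) (m : V * V -> V) (e : V).
Context (T_open : open T) (Om_open : open Om) (m_smooth : smooth_on Om m) (Te : T e)
  (Om_r : forall p, T p -> Om (p, e))
  (m_r : forall p, T p -> m (p, e) = p) (m_l : forall p, T p -> m (e, p) = p)
  (m_T : forall p q, Om (p, q) -> T (m (p, q)))
  (m_assoc : forall p q r, Om (p, q) -> Om (q, r) -> Om (m (p, q), r) ->
     Om (p, m (q, r)) -> m (m (p, q), r) = m (p, m (q, r))).

(** The mixed second-order term of the product at the unit, which is also the derivative at [e]
    along [Y] of the left-invariant field of [Z]. Its antisymmetrization is thus the commutator of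
    left-invariant fields. *)
Definition lg_beta (Y Z : V) : V := pderl Y (pderr Z m) (e, e).
Definition lg_bracket (Y Z : V) : V := lg_beta Y Z - lg_beta Z Y.

Let m_diff x : Om x -> differentiable m x.
Proof. exact: smooth_on_differentiable. Qed.

Let ml_diff v x : Om x -> differentiable (pderl v m) x.
Proof. by apply: smooth_on_differentiable; apply: smooth_on_pderl. Qed.

Let mr_diff v x : Om x -> differentiable (pderr v m) x.
Proof. by apply: smooth_on_differentiable; apply: smooth_on_pderr. Qed.

Let mlr_diff v w x : Om x -> differentiable (pderl v (pderr w m)) x.
Proof.
apply: smooth_on_differentiable.
by apply: smooth_on_pderl; apply: smooth_on_pderr.
Qed.

Let Om_ee : Om (e, e) := Om_r _ Te.

Let near_T p : T p -> \forall q \near p, T q.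
Proof. by move=> Tp; apply: open_nbhs_nbhs. Qed.

Let near_Om_r p q : Om (p, q) -> \forall r \near q, Om (p, r).
Proof. exact: open_near_slicer. Qed.

Let lg_betaE Y Z : lg_beta Y Z = pderr Z (pderl Y m) (e, e) :=
  pderlr_comm Om m (e, e) Om_open m_smooth Om_ee Y Z.

Let mrr_comm p Y Z (Tp : T p) :
    pderr Y (pderr Z m) (p, e) = pderr Z (pderr Y m) (p, e) :=
  pderrr_comm Om m (p, e) Om_open m_smooth (Om_r p Tp) Y Z.

Lemma derive_left_unit Z : pderr Z m (e, e) = Z.
Proof.
rewrite -derive_slicer (near_eq_derive (g := id)) ?derive_id //.
by apply: filterS (near_T _ Te) => q Tq; rewrite m_l.
Qed.

Lemma derive_right_unit Z : pderl Z m (e, e) = Z.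
Proof.
rewrite -derive_slicel (near_eq_derive (g := id)) ?derive_id //.
by apply: filterS (near_T _ Te) => q Tq; rewrite m_r.
Qed.

Lemma is_derive_left_field X Z :
  is_derive e X (fun p => pderr Z m (p, e)) (lg_beta X Z).
Proof. by apply: (is_derive_slicel (pderr Z m)); apply: mr_diff. Qed.

(** Commuting the partial derivatives exchanges the arguments of [lg_beta] relative to the
    left-invariant field, so comparing the two kinds of field produces the bracket. *)
Lemma is_derive_right_field X Z :
  is_derive e X (fun p => pderl Z m (e, p)) (lg_beta Z X).
Proof.
rewrite lg_betaE; by apply: (is_derive_slicer (pderl Z m)); apply: ml_diff.
Qed.

Lemma lg_beta_linearl Z : linear (lg_beta^~ Z).
Proof. by apply: derive_linearl; apply: mr_diff. Qed.

Lemma lg_beta_linearr Y : linear (lg_beta Y).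
Proof.
move=> a u v; rewrite !lg_betaE; by apply: (derive_linearr (pderl Y m)); apply: ml_diff.
Qed.

(** Associativity differentiated in the third factor at [e]: translation by [p] carries the
    left-invariant field at [q] to its value at [m (p, q)]. *)
Lemma left_field_invariant p q Z : Om (p, q) -> T q ->
  pderr Z m (m (p, q), e) = pderr (pderr Z m (q, e)) m (p, q).
Proof.
move=> Opq Tq.
have Tpq := m_T _ _ Opq.
have qd : differentiable (fun r => m (q, r)) e.
  by apply: differentiable_slicer; apply/m_diff/Om_r.
have pd : differentiable (fun s => m (p, s)) q.
  by apply: differentiable_slicer; apply/m_diff.
rewrite -derive_slicer.
transitivity ('D_Z ((fun s => m (p, s)) \o (fun r => m (q, r))) e).
  apply: near_eq_derive.
  have n1 := near_Om_r _ _ (Om_r _ Tpq).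
  have n2 := near_Om_r _ _ (Om_r _ Tq).
  (* As [r] tends to [e], [m (q, r)] tends to [m (q, e) = q], and [(p, q)] lies in the open set
     [Om]. *)
  have n3 : \forall r \near e, Om (p, m (q, r)).
    have cq : (fun r => m (q, r)) @ e --> m (q, e).
      exact: (differentiable_continuous qd).
    by rewrite m_r // in cq; exact: (cq _ (near_Om_r _ _ Opq)).
  near=> r; rewrite /= m_assoc //; [near: r; exact: n2|near: r; exact: n1|].
  by near: r; exact: n3.
rewrite -(m_r q Tq) in pd; rewrite (derive_comp _ _ _ _ _ e Z qd pd) (m_r q Tq).
by rewrite (derive_slicer m q e Z) (derive_slicer m p q).
Unshelve. all: by end_near. Qed.

(** The identity [left_field_invariant] differentiated in [q] at [e] along [Y]: chain rule on one
    side, Leibniz rule on the other. The first term on the right is symmetric in [Y] and [Z], so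
    antisymmetrizing shows that left-invariant fields are closed under commutators. *)
Lemma derive_left_field_left_field p Y Z : T p ->
  pderl (pderr Y m (p, e)) (pderr Z m) (p, e) =
  pderr Y (pderr Z m) (p, e) + pderr (lg_beta Y Z) m (p, e).
Proof.
move=> Tp; have Ope := Om_r _ Tp.
have pd : differentiable (fun q => m (p, q)) e.
  by apply: differentiable_slicer; apply/m_diff.
have Fd : differentiable (fun s => pderr Z m (s, e)) (m (p, e)).
  by rewrite (m_r p Tp); apply: (differentiable_slicel (pderr Z m)); apply: mr_diff.
have <- : 'D_Y ((fun s => pderr Z m (s, e)) \o (fun q => m (p, q))) e =
    pderl (pderr Y m (p, e)) (pderr Z m) (p, e).
  rewrite (derive_comp _ _ _ _ _ e Y pd Fd) (m_r p Tp).
  by rewrite (derive_slicer m p e Y) (derive_slicel (pderr Z m) p e).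
have B : is_derive e Y (fun q => pderr (pderr Z m (q, e)) m (p, q))
    (pderr Y (pderr (pderr Z m (e, e)) m) (p, e) + pderr (lg_beta Y Z) m (p, e)).
  apply: (is_derive_linear_family n (fun q z => pderr z m (p, q))
    (fun z => pderr Y (pderr z m) (p, e))).
  - by apply: filterS (near_Om_r _ _ Ope) => q Opq; apply/derive_linearr/m_diff.
  - move=> a u v; rewrite (mrr_comm p Y _ Tp) (mrr_comm p Y u Tp) (mrr_comm p Y v Tp).
    by apply: (derive_linearr (pderr Y m)); apply: mr_diff.
  - by move=> z; apply: (is_derive_slicer (pderr z m)); apply: mr_diff.
  - exact: is_derive_left_field.
rewrite -[X in pderr Y (pderr X m)](derive_left_unit Z).
case: B => _ <-; apply: near_eq_derive.
near=> q; rewrite /= left_field_invariant //.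
  by near: q; exact: near_Om_r.
by near: q; exact: near_T.
Unshelve. all: by end_near. Qed.

Definition lg_third (X Y Z : V) : V := pderl X (pderl Y (pderr Z m)) (e, e).

Let third_comm X Y Z : lg_third X Y Z = lg_third Y X Z.
Proof. by apply: (pderll_comm Om) => //; apply: smooth_on_pderr. Qed.

Let is_derive_third X z Z :
  is_derive e X (fun p => pderl z (pderr Z m) (p, e)) (lg_third X z Z).
Proof. by apply: (is_derive_slicel (pderl z (pderr Z m))); apply: mlr_diff. Qed.

Let third_linear X Z : linear (fun z => lg_third z X Z).
Proof. by apply: (derive_linearl (pderl X (pderr Z m))); apply: mlr_diff. Qed.

(** On [T] the left-invariant field of [lg_bracket Y Z] is the commutator of the fields of [Y] and
    [Z]; both expressions are differentiated at [e] along [X]. *)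
Lemma lg_beta_bracket X Y Z : lg_beta X (lg_bracket Y Z) =
  lg_third X Y Z + lg_beta (lg_beta X Y) Z - (lg_third X Z Y + lg_beta (lg_beta X Z) Y).
Proof.
have B Y' Z' : is_derive e X (fun p => pderl (pderr Y' m (p, e)) (pderr Z' m) (p, e))
    (lg_third X Y' Z' + lg_beta (lg_beta X Y') Z').
  rewrite -{2}[Y'](derive_left_unit Y').
  apply: (is_derive_linear_family n (fun p z => pderl z (pderr Z' m) (p, e))
    (fun z => lg_third X z Z')).
  - by apply: filterS (near_T _ Te) => q Tq; apply/derive_linearl/mr_diff/Om_r.
  - move=> a u v; rewrite !(third_comm X).
    exact: third_linear.
  - by move=> z; exact: is_derive_third.
  - exact: is_derive_left_field.
have [_ <-] := is_deriveB (B Y Z) (B Z Y).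
have [_ <-] := is_derive_left_field X (lg_bracket Y Z).
apply: near_eq_derive; apply: filterS (near_T _ Te) => p Tp.
rewrite -![(_ + _ : _ -> _) _]/(_ + _) -![(- _ : _ -> _) _]/(- _) /=.
rewrite !derive_left_field_left_field // (mrr_comm p Z Y Tp).
rewrite opprD addrACA subrr add0r /lg_bracket.
by rewrite (linear_subE _ _ _ _ (derive_linearr m p e (m_diff _ (Om_r _ Tp)))).
Qed.

(** Everything expands into values of [lg_third] and nested values of [lg_beta]. Symmetry of
    [lg_third] in its first two arguments leaves three third-order values, and all terms then
    cancel. *)
Lemma lg_bracket_jacobi X Y Z : lg_bracket X (lg_bracket Y Z) =
  lg_bracket (lg_bracket X Y) Z + lg_bracket Y (lg_bracket X Z).
Proof.
have bB u v w : lg_beta (lg_bracket u v) w =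
    lg_beta (lg_beta u v) w - lg_beta (lg_beta v u) w.
  exact: (linear_subE _ _ _ _ (lg_beta_linearl w)).
rewrite {1 3 5}/lg_bracket !lg_beta_bracket !bB (third_comm Z X) (third_comm Z Y) (third_comm Y X).
move: (lg_third X Y Z) (lg_third X Z Y) (lg_third Y Z X) => a b c.
move: (lg_beta (lg_beta X Y) Z) (lg_beta (lg_beta X Z) Y) (lg_beta (lg_beta Y Z) X)
  (lg_beta (lg_beta Z Y) X) (lg_beta (lg_beta Y X) Z) (lg_beta (lg_beta Z X) Y).
move=> d1 d2 d3 d4 d5 d6; apply/rowP => i; rewrite !mxE; ring.
Qed.

Context (h : V -> V -> V -> R).
Context (h_linear : forall p, T p -> forall v, linear (h p ^~ v : V -> R^o))
  (h_sym : forall p u v, h p u v = h p v u)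
  (h_derivable : forall u v X, derivable (fun p => h p u v : R^o) e X)
  (h_left : forall p, T p -> forall Y Z,
     h p (pderr Y m (p, e)) (pderr Z m (p, e)) = h e Y Z)
  (h_right : forall p, T p -> forall Y Z,
     h p (pderl Y m (e, p)) (pderl Z m (e, p)) = h e Y Z).

Let h' X u v : R := 'D_X (fun p => h p u v : R^o) e.

Let h'_linear X v : linear (h' X ^~ v : V -> R^o).
Proof.
move=> a u w; rewrite /h'.
have [_ <-] := is_deriveD (is_deriveZ a (derivableP (h_derivable u v X)))
   (derivableP (h_derivable w v X)).
apply: near_eq_derive; apply: filterS (near_T _ Te) => p Tp.
exact: h_linear.
Qed.

Let h'_sym X u v : h' X u v = h' X v u.
Proof. by apply: near_eq_derive; near do exact: h_sym.
Unshelve. all: by end_near. Qed.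

(** The Leibniz rule for linear families, used once in each argument of the metric. *)
Let is_derive_h X (u1 u2 : V -> V) d1 d2 :
  is_derive e X u1 d1 -> is_derive e X u2 d2 ->
  is_derive e X (fun p => h p (u1 p) (u2 p) : R^o)
    (h' X (u1 e) (u2 e) + h e (u1 e) d2 + h e d1 (u2 e)).
Proof.
move=> u1d u2d.
have hlr p u : T p -> linear (h p u : V -> R^o).
  by move=> Tp a v w; rewrite !(h_sym p u); exact: h_linear.
apply: (is_derive_linear_family n (fun p z => h p z (u2 p) : R^o)
  (fun z => h' X z (u2 e) + h e z d2 : R^o)) => //.
- by apply: filterS (near_T _ Te) => p Tp; exact: h_linear.
- move=> a u v; rewrite [h' _ _ _]h'_linear [h e _ _]h_linear //.
  by rewrite scalerDr addrACA.
- move=> z; apply: (is_derive_linear_family n (fun p w => h p z w : R^o) (h' X z)) => //.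
  + by apply: filterS (near_T _ Te) => p Tp; exact: hlr.
  + by move=> a v w; rewrite !(h'_sym X z); exact: h'_linear.
Qed.

(* Differentiating both invariance identities of the metric at the unit and
   subtracting eliminates the derivative of the metric. *)
Lemma lg_bracket_skew X Y Z :
  h e (lg_bracket X Y) Z = - h e Y (lg_bracket X Z).
Proof.
have zero (f : V -> R^o) d (c : R^o) : is_derive e X f d ->
    (forall p, T p -> f p = c) -> d = 0.
  move=> [_ <-] fc; rewrite -(derive_cst c e X); apply: near_eq_derive.
  by apply: filterS (near_T _ Te).
have L := zero _ _ _ (is_derive_h X _ _ _ _ (is_derive_left_field X Y)
  (is_derive_left_field X Z)) (fun p Tp => h_left p Tp Y Z).
have Rr := zero _ _ _ (is_derive_h X _ _ _ _ (is_derive_right_field X Y)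
  (is_derive_right_field X Z)) (fun p Tp => h_right p Tp Y Z).
move: L Rr; rewrite !derive_left_unit !derive_right_unit.
have hB u v w : h e (u - v) w = h e u w - h e v w.
  exact: (linear_subE _ _ _ _ (h_linear e Te w)).
rewrite /lg_bracket hB (h_sym e Y (_ - _)) hB !(h_sym e _ Y).
move: (h' X Y Z) (h e Y (lg_beta X Z)) (h e Y (lg_beta Z X)) (h e (lg_beta X Y) Z)
  (h e (lg_beta Y X) Z) => a b c d f E1 E2.
by apply/eqP; rewrite -subr_eq0 -(subrr 0) -{1}E1 -E2; apply/eqP; ring.
Qed.

End LocalGroup.

(** * The Lie group in its chart at the identity *)

Section ChartLemmas.
Context {R : realType} {n : nat}.

Lemma cfromP (M : topologicalType) (c : chart R n M) p :
  ctarget c p -> csource c (cfrom c p) /\ c (cfrom c p) = p.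
Proof. by move=> [x cx <-]; rewrite ctoK. Qed.

Lemma ctarget_cto (M : topologicalType) (c : chart R n M) x :
  csource c x -> ctarget c (c x).
Proof. by exists x. Qed.

Lemma near_eq_diff (V W : normedModType R) (f g : V -> W) x v :
  (\forall y \near x, f y = g y) -> differentiable f x -> 'd g x v = 'd f x v.
Proof.
move=> fg fd; have gd := near_eq_differentiable _ _ _ _ fg fd.
by rewrite -!deriveE //; apply/esym/near_eq_derive.
Qed.

End ChartLemmas.

Section LieGroupChart.
Context {R : realType} {n : nat} (G : lieGroupType R n).
Local Notation V := 'rV[R]_n.
Local Notation phi := (chart_at (1%g : G)).
Local Notation psi := (cfrom phi).
Local Notation e := (phi 1%g).
Local Notation T := (ctarget phi).

Definition lie_mul_chart (p : V * V) : V := phi (psi p.1 * psi p.2)%g.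

(** This is the domain in [smooth_map2] with all three charts equal to the one at 1, so smoothness
    of the product is read off directly. *)
Definition lie_mul_dom : set (V * V) :=
  [set p | [/\ T p.1, T p.2 & csource phi (psi p.1 * psi p.2)%g]].

Local Notation m := lie_mul_chart.
Local Notation Om := lie_mul_dom.

Lemma lie_mul_chart_smooth : smooth_on Om m.
Proof. by apply: (lie_mul_smooth (s := G)).2; exact: chart_at_atlas. Qed.

Lemma lie_mul_dom_open : open Om.
Proof.
rewrite openE => p [T1 T2 S]; rewrite /interior.
have n1 : \forall z \near p, T z.1.
  have : nbhs p.1 T by apply: open_nbhs_nbhs; split => //; exact: ctarget_open.
  exact: (@cvg_fst _ _ (nbhs p.1) (nbhs p.2)).
have n2 : \forall z \near p, T z.2.
  have : nbhs p.2 T by apply: open_nbhs_nbhs; split => //; exact: ctarget_open.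
  exact: (@cvg_snd _ _ (nbhs p.1) (nbhs p.2)).
have n3 : \forall z \near p, csource phi (psi z.1 * psi z.2)%g.
  have S' : nbhs (psi p.1 * psi p.2)%g (csource phi).
    by apply: open_nbhs_nbhs; split => //; exact: csource_open.
  (* [psi] is known to be continuous only at points of [T], so continuity is followed pointwise at
     [p]. *)
  have c1 : {for p, continuous (fun z : V * V => psi z.1)}.
    by apply: (@continuous_comp _ _ _ fst psi); [exact: cvg_fst|exact: cfrom_continuous T1].
  have c2 : {for p, continuous (fun z : V * V => psi z.2)}.
    by apply: (@continuous_comp _ _ _ snd psi); [exact: cvg_snd|exact: cfrom_continuous T2].
  have mc := (lie_mul_smooth (s := G)).1 (psi p.1, psi p.2).
  have := cvg_comp _ _ (cvg_pair c1 c2) mc.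
  exact.
by near=> z; split; near: z.
Unshelve. all: by end_near. Qed.

Lemma csource1 : csource phi (1%g : G).
Proof. exact: mem_chart_at. Qed.

Lemma ctarget1 : T e.
Proof. exact/ctarget_cto/csource1. Qed.

Lemma cfrom1 : psi e = 1%g.
Proof. exact/ctoK/csource1. Qed.

Lemma lie_mul_dom_r p : T p -> Om (p, e).
Proof.
by move=> Tp; split => //=; rewrite ?cfrom1 ?mulg1; [exact: ctarget1|exact: (cfromP _ _ _ Tp).1].
Qed.

Lemma lie_mul_dom_l p : T p -> Om (e, p).
Proof.
by move=> Tp; split => //=; rewrite ?cfrom1 ?mul1g; [exact: ctarget1|exact: (cfromP _ _ _ Tp).1].
Qed.

Lemma lie_mul_chart_r p : T p -> m (p, e) = p.
Proof. by move=> Tp; rewrite /m /= cfrom1 mulg1; exact: (cfromP _ _ _ Tp).2. Qed.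

Lemma lie_mul_chart_l p : T p -> m (e, p) = p.
Proof. by move=> Tp; rewrite /m /= cfrom1 mul1g; exact: (cfromP _ _ _ Tp).2. Qed.

Lemma lie_mul_chart_target p q : Om (p, q) -> T (m (p, q)).
Proof. by move=> [_ _ S]; exact: ctarget_cto. Qed.

Lemma lie_mul_chartK p q : Om (p, q) -> psi (m (p, q)) = (psi p * psi q)%g.
Proof. by move=> [_ _ S]; exact: ctoK. Qed.

Lemma lie_mul_chart_assoc p q r : Om (p, q) -> Om (q, r) ->
  Om (m (p, q), r) -> Om (p, m (q, r)) -> m (m (p, q), r) = m (p, m (q, r)).
Proof.
move=> Opq Oqr _ _; rewrite -[LHS]/(phi (psi (m (p, q)) * psi r)%g).
rewrite -[RHS]/(phi (psi p * psi (m (q, r)))%g).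
by rewrite (lie_mul_chartK _ _ Opq) (lie_mul_chartK _ _ Oqr) mulgA.
Qed.

Lemma left_invariantE Z p : T p -> left_invariant G Z p = pderr Z m (p, e).
Proof.
move=> Tp; rewrite -derive_slicer deriveE //.
apply: differentiable_slicer.
exact: (smooth_on_differentiable _ _ _ _ lie_mul_chart_smooth (lie_mul_dom_r _ Tp)).
Qed.

Lemma lie_bracketE Y Z : lie_bracket G Y Z = lg_bracket m e Y Z.
Proof.
have D X W : 'D_X (left_invariant G W) e = lg_beta m e X W.
  have [_ <-] := is_derive_left_field _ _ _ _ lie_mul_chart_smooth ctarget1
    lie_mul_dom_r X W.
  apply: near_eq_derive.
  have : nbhs e T by apply: open_nbhs_nbhs; split; [exact: ctarget_open|exact: ctarget1].
  by apply: filterS => p Tp; exact: left_invariantE.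
by rewrite /lie_bracket /= !D.
Qed.

Lemma lie_bracket_linear Y : linear (lie_bracket G Y).
Proof.
move=> a u v; rewrite !lie_bracketE /lg_bracket.
rewrite (lg_beta_linearr _ _ _ _ lie_mul_dom_open lie_mul_chart_smooth ctarget1
  lie_mul_dom_r).
rewrite (lg_beta_linearl _ _ _ _ lie_mul_chart_smooth ctarget1 lie_mul_dom_r Y a u v).
by rewrite scalerBr opprD addrACA.
Qed.

Lemma lie_bracketC Y Z : lie_bracket G Y Z = - lie_bracket G Z Y.
Proof. by rewrite /lie_bracket /= opprB. Qed.

Lemma lie_bracket_jacobi X Y Z : lie_bracket G X (lie_bracket G Y Z) =
  lie_bracket G (lie_bracket G X Y) Z + lie_bracket G Y (lie_bracket G X Z).
Proof.
rewrite !lie_bracketE.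
apply: (lg_bracket_jacobi T Om) => //.
- exact: ctarget_open.
- exact: lie_mul_dom_open.
- exact: lie_mul_chart_smooth.
- exact: ctarget1.
- exact: lie_mul_dom_r.
- exact: lie_mul_chart_r.
- exact: lie_mul_chart_l.
- exact: lie_mul_chart_target.
- exact: lie_mul_chart_assoc.
Qed.

(** [tmap] reads the target in the preferred chart at [F 1], whereas [f] expresses [F] in the chart
    at 1 on both sides. The chain rule inserts the differential of the transition map. *)
Lemma tmap_unit (F : G -> G) (f : V -> V) Y :
  csource phi (F 1%g) -> differentiable f e -> f e = phi (F 1%g) ->
  (\forall q \near e, psi (f q) = F (psi q)) ->
  tmap F 1%g Y = 'd (chart_at (F 1%g) \o psi) (phi (F 1%g)) ('D_Y f e).
Proof.
move=> SF fd fe nf; rewrite /tmap; set d := chart_at (F 1%g).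
have dd : differentiable (d \o psi) (f e).
  rewrite fe; apply: smooth_on_differentiable.
    by apply: atlas_smooth; exact: chart_at_atlas.
  by exists (F 1%g) => //; split => //; exact: mem_chart_at.
have nE : \forall q \near e, ((d \o psi) \o f) q = (d \o F \o psi) q.
  by apply: filterS nf => q /= ->.
have E1 := near_eq_diff _ _ _ _ _ Y nE (differentiable_comp fd dd).
have E2 := congr1 (fun L => L Y) (diff_comp fd dd).
have E3 := congr2 (fun p (v : V) => 'd (d \o psi) p v) fe
  (esym (@deriveE _ _ _ f e Y fd)).
exact: etrans E1 (etrans E2 E3).
Qed.

Context (g : G -> V -> V -> R) (g_biinv : biinvariant_metric g).

(** The metric lives in a chart varying with the point; the transition differentials pull it back to
    the single chart at 1, in the form given by [metric_smooth]. *)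
Definition metric_chart (p u v : V) : R :=
  g (psi p) ('d (chart_at (psi p) \o psi) p u) ('d (chart_at (psi p) \o psi) p v).

(** In the chart at 1, left translation by [psi p] sends [W] to [pderr W m (p, e)]; the transition
    differential from [tmap_unit] is the one built into [metric_chart]. *)
Lemma metric_chart_left p Y Z : T p ->
  metric_chart p (pderr Y m (p, e)) (pderr Z m (p, e)) = g 1%g Y Z.
Proof.
move=> Tp; have [_ gl _] := g_biinv.
have [Sp phip] := cfromP _ _ _ Tp; have Ope := lie_mul_dom_r _ Tp.
have md : differentiable m (p, e).
  exact: (smooth_on_differentiable _ _ _ _ lie_mul_chart_smooth Ope).
have tE W : tmap (fun z : G => psi p * z)%g 1%g W =
    'd (chart_at (psi p * 1)%g \o psi) (phi (psi p * 1)%g) (pderr W m (p, e)).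
  rewrite -derive_slicer.
  apply: (tmap_unit _ (fun q => m (p, q))); rewrite ?mulg1 //.
  - exact: differentiable_slicer.
  - by rewrite lie_mul_chart_r // phip.
  - have := open_near_slicer _ _ _ lie_mul_dom_open Ope.
    by apply: filterS => q; exact: lie_mul_chartK.
rewrite -(gl (psi p) 1%g Y Z) (tE Y) (tE Z) mulg1 phip //.
Qed.

Lemma metric_chart_right p Y Z : T p ->
  metric_chart p (pderl Y m (e, p)) (pderl Z m (e, p)) = g 1%g Y Z.
Proof.
move=> Tp; have [_ _ gr] := g_biinv.
have [Sp phip] := cfromP _ _ _ Tp; have Oep := lie_mul_dom_l _ Tp.
have md : differentiable m (e, p).
  exact: (smooth_on_differentiable _ _ _ _ lie_mul_chart_smooth Oep).
have tE W : tmap (fun z : G => z * psi p)%g 1%g W =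
    'd (chart_at (1 * psi p)%g \o psi) (phi (1 * psi p)%g) (pderl W m (e, p)).
  rewrite -derive_slicel.
  apply: (tmap_unit _ (fun q => m (q, p))); rewrite ?mul1g //.
  - exact: differentiable_slicel.
  - by rewrite lie_mul_chart_l // phip.
  - have := open_near_slicel _ _ _ lie_mul_dom_open Oep.
    by apply: filterS => q; exact: lie_mul_chartK.
rewrite -(gr (psi p) 1%g Y Z) (tE Y) (tE Z) mul1g phip //.
Qed.

Lemma lie_bracket_skew X Y Z :
  g 1%g (lie_bracket G X Y) Z = - g 1%g Y (lie_bracket G X Z).
Proof.
have [[glin gsym _ gsmooth] _ _] := g_biinv.
(* Left invariance at [p = e], where [pderr W m (e, e) = W], settles this without computing the
   transition differential. *)
have h1 u v : metric_chart e u v = g 1%g u v.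
  have lu W : pderr W m (e, e) = W.
    by apply: (derive_left_unit T);
      [exact: ctarget_open|exact: ctarget1|exact: lie_mul_chart_l].
  by have := metric_chart_left e u v ctarget1; rewrite (lu u) (lu v).
rewrite !lie_bracketE -!h1.
apply: (lg_bracket_skew T Om) => //.
- exact: ctarget_open.
- exact: lie_mul_dom_open.
- exact: lie_mul_chart_smooth.
- exact: ctarget1.
- exact: lie_mul_dom_r.
- exact: lie_mul_chart_r.
- exact: lie_mul_chart_l.
- by move=> p _ w a u v; rewrite /metric_chart linearP glin.
- by move=> p u v; rewrite /metric_chart gsym.
- move=> u v W; apply: diff_derivable.
  apply: (smooth_on_differentiable _ T); last exact: ctarget1.
  exact: (gsmooth phi u v (chart_at_atlas _)).
- by move=> p Tp A B; rewrite h1 metric_chart_left.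
- by move=> p Tp A B; rewrite h1 metric_chart_right.
Qed.

End LieGroupChart.

(** * Lie algebras with an invariant inner product *)

Section Pencils.
Context {R : realType}.

Lemma det_pencil_horner k (N0 N1 : 'M[R]_k) :
  exists p : {poly R}, forall t, p.[t] = \det (N0 + t *: N1).
Proof.
exists (\det (map_mx polyC N0 + 'X *: map_mx polyC N1)) => t.
rewrite -horner_evalE -det_map_mx; congr (\det _); apply/matrixP => i j.
by rewrite !mxE -[LHS]/((_ + 'X * _).[t]) !hornerE.
Qed.

Lemma poly_nonroot_small (p : {poly R}) (e : R) : p != 0 -> 0 < e ->
  exists t, [/\ 0 < t, t < e & p.[t] != 0].
Proof.
(* The denominators start at 2 to stay strictly below [e]; a nonzero [p] has fewer than [size p]
   roots, so one of the [size p] candidates is not a root. *)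
move=> p0 e0; pose r (i : nat) : R := e / i.+2%:R.
pose rs := [seq r i | i <- iota 0 (size p)].
have rinj : injective r.
  by move=> i j /(mulfI (lt0r_neq0 e0)) /invr_inj /eqP; rewrite eqr_nat => /eqP[].
have : ~~ all (root p) rs.
  apply/negP => allr; have := max_poly_roots p0 allr.
  by rewrite map_inj_uniq ?iota_uniq // size_map size_iota ltnn => /(_ isT).
move=> /allPn[_ /mapP[i _ ->] pr]; exists (r i); split => //.
- by rewrite divr_gt0.
- by rewrite ltr_pdivrMr // ltr_pMr // ltr1n.
Qed.

(** Since [w *m (M + t *: M') = t *: (w *m M')], the row [w *m M'] lies in the row space of the
    pencil for every nonzero [t]. Were it outside that of [M], adjoining it to perturbed basis rows
    would give rank [\rank M + 1] for some such [t]. *)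
Lemma rank_pencil_max n k (M M' : 'M[R]_(n, k)) (w : 'rV[R]_n) :
  (forall t, (\rank (M + t *: M')%R <= \rank M)%N) -> w *m M = 0 ->
  (w *m M' <= M)%MS.
Proof.
move=> rmax wM; apply/negPn/negP => nsub.
have /submxP[C CE] : (row_base M <= M)%MS by rewrite eq_row_base.
pose N t := col_mx (C *m (M + t *: M')) (w *m M').
have Nsub t : t != 0 -> (N t <= (M + t *: M')%R)%MS.
  move=> t0; rewrite col_mx_sub; apply/andP; split; first exact: submxMl.
  have -> : w *m M' = t^-1 *: (w *m (M + t *: M')).
    by rewrite mulmxDr wM add0r -scalemxAr scalerA mulVf // scale1r.
  by rewrite scalemx_sub // submxMl.
(* The right inverse [B] at [t = 0] makes [\det (N t *m B)] a polynomial in [t] with value 1 at 0,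
   so [N t] stays row free at some positive [t]. *)
have /row_freeP[B NB] : row_free (N 0).
  rewrite /N scale0r addr0 -CE -row_leq_rank -addsmxE.
  have rw : \rank (w *m M') = 1%N.
    apply/eqP; rewrite rank_rV; suff -> : w *m M' != 0 by [].
    by apply: contra nsub => /eqP ->; exact: sub0mx.
  (* A nonzero intersection with a space of rank 1 would be all of it, putting [w *m M'] in the row
     space of [M]. *)
  have cap0 : (row_base M :&: w *m M')%MS = 0.
    apply/eqP; rewrite -mxrank_eq0; have := mxrankS (capmxSr (row_base M) (w *m M')).
    rewrite rw leq_eqVlt ltnS leqn0 => /orP[/eqP rE|//]; case/negP: nsub.
    rewrite -(eq_row_base M); apply: submx_trans (capmxSl _ (w *m M')).
    have [_ /esym] := mxrank_leqif_sup (capmxSr (row_base M) (w *m M')).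
    by rewrite rE rw eqxx.
  by rewrite mxrank_disjoint_sum // rw eq_row_base.
have [p pE] := det_pencil_horner _ (col_mx (C *m M) (w *m M') *m B)
  (col_mx (C *m M') (0 : 'rV_k) *m B).
have pN t : p.[t] = \det (N t *m B).
  rewrite pE scalemxAl -mulmxDl scale_col_mx scaler0 add_col_mx addr0.
  by rewrite /N mulmxDr scalemxAr.
have p0 : p != 0.
  apply/eqP => p0; have := pN 0; rewrite p0 horner0 NB det1 => /eqP.
  by rewrite eq_sym oner_eq0.
have [t [t0 _ pt]] := poly_nonroot_small p 1 p0 ltr01.
have : row_free (N t).
  apply/row_freeP; exists (B *m invmx (N t *m B)).
  by rewrite mulmxA mulmxV // unitmxE -pN unitfE.
rewrite -row_leq_rank => rN.
have := leq_trans rN (mxrankS (Nsub t (lt0r_neq0 t0))).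
by move=> /leq_trans /(_ (rmax t)); rewrite addn1 ltnn.
Qed.

End Pencils.

(** * Pairs with trivial common centralizer *)

Section InvariantLieAlgebra.
Context {R : realType} {n : nat}.
Context (br : 'rV[R]_n -> 'rV[R]_n -> 'rV[R]_n) (ip : 'rV[R]_n -> 'rV[R]_n -> R).
Context (br_linear : forall X, linear (br X))
  (br_anti : forall X Y, br X Y = - br Y X)
  (br_jacobi : forall X Y Z, br X (br Y Z) = br (br X Y) Z + br Y (br X Z))
  (ip_linear : forall a u v w, ip (a *: u + v) w = a * ip u w + ip v w)
  (ip_sym : forall u v, ip u v = ip v u)
  (ip_pos : forall u, u != 0 -> 0 < ip u u)
  (ip_inv : forall X Y Z, ip (br X Y) Z = - ip Y (br X Z))
  (br_center : forall W, (forall Z, br Z W = 0) -> W = 0).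

Definition ad_mx (X : 'rV[R]_n) : 'M[R]_n := \matrix_i br X (delta_mx 0 i).

Lemma mul_ad_mx X W : W *m ad_mx X = br X W.
Proof.
pose lB := GRing.isLinear.Build _ _ _ _ (br X) (br_linear X).
pose B : {linear 'rV[R]_n -> 'rV[R]_n} := HB.pack (br X) lB.
rewrite -[br X]/(B : _ -> _) {2}(row_sum_delta W) linear_sum mulmx_sum_row.
by apply: eq_bigr => i _; rewrite linearZ rowK.
Qed.

Lemma br_linearl W : linear (br^~ W).
Proof.
by move=> a u v; rewrite (br_anti _ W) br_linear opprD -scalerN -(br_anti u W) -(br_anti v W).
Qed.

(** Its left kernel is the common centralizer of [X] and [Y], and it depends linearly on the pair,
    so lines of pairs become matrix pencils. *)
Definition ad_pair_mx X Y : 'M[R]_(n, n + n) := row_mx (ad_mx X) (ad_mx Y).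

Lemma ad_pair_mxD X Y X' Y' t : ad_pair_mx (X + t *: X') (Y + t *: Y') =
  ad_pair_mx X Y + t *: ad_pair_mx X' Y'.
Proof.
rewrite /ad_pair_mx scale_row_mx add_row_mx; congr row_mx; apply/row_matrixP => i;
  by rewrite linearD linearZ /= !rowK addrC br_linearl addrC.
Qed.

Lemma ip0_eq0 u : (forall v, ip u v = 0) -> u = 0.
Proof.
by move=> u0; apply/eqP/negPn/negP => /ip_pos; rewrite u0 ltxx.
Qed.

Lemma ip0l v : ip 0 v = 0.
Proof. by have := ip_linear (-1) 0 0 v; rewrite scaler0 addr0 mulN1r addNr. Qed.

Lemma ipNr u v : ip u (- v) = - ip u v.
Proof.
by rewrite ip_sym -[- v]addr0 -scaleN1r ip_linear ip0l addr0 mulN1r ip_sym.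
Qed.

(* At a pair of maximal rank, every [(br Y' W, br X' W)] with [W] in the common
   centralizer is of the form [(br Y V, br X V)]; invariance and the Jacobi
   identity then force [W] to be central. *)
Lemma exists_trivial_common_centralizer :
  exists Y X, row_free (ad_pair_mx Y X).
Proof.
have [Y [X rmax]] : exists Y X, forall Y' X',
    (\rank (ad_pair_mx Y' X') <= \rank (ad_pair_mx Y X))%N.
  pose P k := `[< exists Y X, \rank (ad_pair_mx Y X) = k >].
  have P0 : exists k, P k by exists (\rank (ad_pair_mx 0 0)); apply/asboolP; exists 0, 0.
  have Pn k : P k -> (k <= n)%N by move=> /asboolP[Y [X <-]]; exact: rank_leq_row.
  case: (ex_maxnP P0 Pn) => k /asboolP[Y [X <-]] kmax.
  by exists Y, X => Y' X'; apply: kmax; apply/asboolP; exists Y', X'.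
exists Y, X; rewrite -kermx_eq0; apply/rowV0P => W /sub_kermxP.
rewrite mul_mx_row !mul_ad_mx => /eqP; rewrite row_mx_eq0 => /andP[/eqP YW /eqP XW].
have surj Y' X' : exists V, br Y V = br Y' W /\ br X V = br X' W.
  have : (W *m ad_pair_mx Y' X' <= ad_pair_mx Y X)%MS.
    apply: (rank_pencil_max _ _ _ (ad_pair_mx Y' X')) => [t|].
      by rewrite -ad_pair_mxD; exact: rmax.
    by rewrite mul_mx_row !mul_ad_mx YW XW row_mx0.
  move=> /submxP[V]; rewrite !mul_mx_row !mul_ad_mx => /eq_row_mx[-> ->].
  by exists V.
have brN U V : br U V = 0 -> br V U = 0 by rewrite (br_anti V) => ->; rewrite oppr0.
have br0 U : br U 0 = 0 by rewrite -(mul_ad_mx U) mul0mx.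
have br00 U : br 0 U = 0 by rewrite br_anti br0 oppr0.
apply: br_center => Z.
have [V [YV XV]] := surj 0 Z; rewrite br00 in YV.
have WV : br W V = 0.
  apply: ip0_eq0 => U; rewrite ip_inv.
  (* With this choice [br U W] is [br Y V']: the image of [br W] lies in that of [br Y], to which
     [V] is orthogonal because it commutes with [Y]. *)
  have [V' [YV' _]] := surj U 0.
  rewrite br_anti -YV'.
  by rewrite ipNr -ip_inv YV ip0l oppr0.
have WZW : br W (br Z W) = 0.
  by rewrite -XV br_jacobi WV br0 (brN _ _ XW) br00 addr0.
(* By invariance the squared norm of [br Z W] equals [ip Z (br W (br Z W))], which vanishes by
   [WZW]. *)
apply/eqP/negPn/negP => /ip_pos.
by rewrite {1}(br_anti Z W) ip_sym ipNr ip_sym ip_inv WZW ip_sym ip0l !oppr0 ltxx.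
Qed.

Lemma row_free_ad_pair Y X : reflect
  (forall W, br Y W = 0 -> br X W = 0 -> W = 0) (row_free (ad_pair_mx Y X)).
Proof.
rewrite -kermx_eq0; apply: (iffP rowV0P) => H W.
  move=> YW XW; apply: H; apply/sub_kermxP.
  by rewrite mul_mx_row !mul_ad_mx YW XW row_mx0.
move=> /sub_kermxP; rewrite mul_mx_row !mul_ad_mx => /eqP.
by rewrite row_mx_eq0 => /andP[/eqP YW /eqP XW]; exact: H.
Qed.

(** If [X] and [Y] are orthogonal, replacing [X] by [X + Y] keeps the common centralizer and makes
    the pairing [ip Y Y], which is positive once [Y != 0]. *)
Lemma exists_nonorthogonal_trivial_centralizer : (0 < n)%N ->
  exists Y X, row_free (ad_pair_mx Y X) /\ ip X Y != 0.
Proof.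
move=> n0; have [Y [X YX]] := exists_trivial_common_centralizer.
have br_self U : br U U = 0.
  apply/rowP => i; have /eqP := congr1 (fun M : 'rV[R]_n => M 0 i) (br_anti U U).
  by rewrite !mxE -addr_eq0 -mulr2n mulrn_eq0 => /eqP.
have br0 U : br 0 U = 0 by rewrite br_anti -(mul_ad_mx U) mul0mx oppr0.
have Y0 : Y != 0.
  apply/eqP => Y0; move/row_free_ad_pair: YX; rewrite {}Y0 => H.
  (* If [Y = 0], then [X] itself is in the common centralizer, hence zero; then every vector is,
     including the nonzero [const_mx 1]. *)
  have X0 : X = 0 by exact: H.
  have := H (const_mx 1); rewrite X0 br0 => /(_ erefl erefl) /matrixP.
  by move=> /(_ 0 (Ordinal n0)) /eqP; rewrite !mxE oner_eq0.
have [XY0|XY0] := eqVneq (ip X Y) 0; last by exists Y, X.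
exists Y, (X + Y); split; last first.
  by rewrite -[X]scale1r ip_linear XY0 mulr0 add0r gt_eqF // ip_pos.
apply/row_free_ad_pair => W YW.
rewrite -[X]scale1r br_linearl YW addr0 scale1r.
by move/row_free_ad_pair: YX; apply.
Qed.

End InvariantLieAlgebra.

(** * Differentiability and the Riesz isomorphism *)

Section Differentiability.
Context {R : realType} {E : normedModType R}.

Lemma differentiable_row_linear n (W : normedModType R) (L : 'rV[R]_n -> W)
    (f : E -> 'rV[R]_n) x :
  linear L -> differentiable f x -> differentiable (fun p => L (f p)) x.
Proof.
move=> Llin fd; pose lL := GRing.isLinear.Build _ _ _ _ L Llin.
pose L' : {linear 'rV[R]_n -> W} := HB.pack L lL.
have -> : (fun p => L (f p)) =
    \sum_(i < n) (fun p => (f p 0 i : R) *: L (delta_mx 0 i)).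
  apply/funext => p; rewrite fct_sumE -[L]/(L' : _ -> _) {1}(row_sum_delta (f p)).
  by rewrite linear_sum; apply: eq_bigr => i _; rewrite linearZ.
apply: differentiable_sum => i; apply: differentiableZl.
apply: (@differentiable_comp _ _ _ _ f (fun N : 'rV[R]_n => N 0 i : R)) => //.
exact: differentiable_coord.
Qed.

Lemma differentiable_coapp n (f : E -> 'rV[R]_n) (c : E -> 'cV[R]_n) x :
  differentiable f x -> differentiable c x ->
  differentiable (fun p => coapp (c p) (f p) : R^o) x.
Proof.
move=> fd cd.
have -> : (fun p => coapp (c p) (f p) : R^o) =
    \sum_(i < n) ((fun p => f p 0 i : R) * (fun p => c p i 0 : R)).
  by apply/funext => p; rewrite fct_sumE /coapp mxE.
apply: differentiable_sum => i; apply: differentiableM.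
- apply: (@differentiable_comp _ _ _ _ f (fun N : 'rV[R]_n => N 0 i : R)) => //.
  exact: differentiable_coord.
- apply: (@differentiable_comp _ _ _ _ c (fun N : 'cV[R]_n => N i 0 : R)) => //.
  exact: differentiable_coord.
Qed.

Lemma differentiable_det k (N : E -> 'M[R]_k) x :
  (forall i j, differentiable (fun p => N p i j : R) x) ->
  differentiable (fun p => \det (N p) : R) x.
Proof.
move=> Nd.
have prodd (s : seq 'I_k) (f : 'I_k -> E -> R) :
    (forall i, differentiable (f i) x) ->
    differentiable (fun p => \prod_(i <- s) f i p) x.
  move=> fd; elim: s => [|i s IH].
    by rewrite (_ : (fun _ => _) = cst 1) //; apply/funext => p; rewrite big_nil.
  rewrite (_ : (fun _ => _) = f i * (fun p => \prod_(i <- s) f i p)).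
    exact: differentiableM.
  by apply/funext => p; rewrite big_cons.
have sumd (I : Type) (s : seq I) (f : I -> E -> R) :
    (forall i, differentiable (f i) x) ->
    differentiable (fun p => \sum_(i <- s) f i p) x.
  move=> fd; elim: s => [|i s IH].
    by rewrite (_ : (fun _ => _) = cst 0) //; apply/funext => p; rewrite big_nil.
  rewrite (_ : (fun _ => _) = f i + (fun p => \sum_(i <- s) f i p)).
    exact: differentiableD.
  by apply/funext => p; rewrite big_cons.
have scale (c : R) (f : E -> R) :
    differentiable f x -> differentiable (fun p => c * f p) x.
  exact: (@differentiableM _ _ (cst c)).
by apply: sumd => s; apply: scale; apply: prodd => i.
Qed.

(** Along the lines tested below every l_j is a polynomial of degree at most 2 in [h], so its
    differential there is the linear coefficient. *)
Lemma derive_quadratic (f : E -> R^o) x v (c1 c2 : R) :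
  (forall h : R, f (h *: v + x) = f x + h * c1 + h ^+ 2 * c2) -> 'D_v f x = c1.
Proof.
move=> fE; pose P : {poly R} := (f x)%:P + c1 *: 'X + c2 *: 'X^2.
have -> : 'D_v f x = 'D_(1 : R) (horner P : R -> R^o) 0.
  apply: derive_along => h; rewrite fE addr0 [h *: 1]mulr1.
  by rewrite !hornerD !hornerZ hornerC hornerX hornerXn; ring.
have [_ ->] := is_derive_poly P 0.
by rewrite /P !derivD derivC !derivZ derivX derivXn !hornerE.
Qed.

Lemma smooth_on_cst (W : normedModType R) (A : set E) (c : W) :
  smooth_on A (fun=> c).
Proof.
move=> k; elim: k c => [|k IH] c /=; first by move=> x _; exact: cst_continuous.
split=> [x _|v]; first exact: differentiable_cst.
have -> : 'D_v (fun=> c) = (fun=> 0) by apply/funext => x; exact: derive_cst.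
exact: IH.
Qed.

End Differentiability.

Lemma smooth_on_line {R : realType} {E : normedModType R} (A : set R^o) (p v : E) :
  smooth_on A (fun t : R^o => p + t *: v).
Proof.
have d (x : R^o) : differentiable (fun t : R^o => p + t *: v) x.
  apply: (@differentiableD _ _ _ (cst p)) => //.
case=> [|k] /=; first by move=> x _; exact: differentiable_continuous.
split=> [x _|w]; first exact: d.
have -> : 'D_w (fun t : R^o => p + t *: v) = (fun=> w *: v).
  apply/funext => x; rewrite -[RHS](derive_id (p + x *: v)).
  by apply: derive_along => h; rewrite scalerDl scalerA addrCA.
exact: smooth_on_cst.
Qed.

(** * The Riesz isomorphism in an orthonormal basis *)

Section OrthonormalBasis.
Context {R : realType} {n : nat} (G : lieGroupType R n).
Context (g : G -> 'rV[R]_n -> 'rV[R]_n -> R) (A : 'I_n -> 'rV[R]_n).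
Context (g_metric : riemannian_metric g) (A_basis : orthonormal_basis g A).
Local Notation ip := (g 1%g).

Let ip_linear w : linear (ip^~ w : 'rV[R]_n -> R^o).
Proof. by move=> a u v; exact: metric_linear. Qed.

Let ip_linearr w : linear (ip w : 'rV[R]_n -> R^o).
Proof. by move=> a u v; rewrite !(Defs.metric_sym g_metric _ w); exact: ip_linear. Qed.

Lemma coapp_linear (xi : 'cV[R]_n) : linear (coapp xi : 'rV[R]_n -> R^o).
Proof. by move=> a u v; rewrite /coapp mulmxDl -scalemxAl !mxE. Qed.

Lemma coapp_linearl (Y : 'rV[R]_n) : linear (fun xi => coapp xi Y : R^o).
Proof. by move=> a u v; rewrite /coapp mulmxDr -scalemxAr !mxE. Qed.

Lemma linear_basis_ext (L L' : 'rV[R]_n -> R^o) : linear L -> linear L' ->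
  (forall i, L (A i) = L' (A i)) -> L =1 L'.
Proof.
move=> Ll Ll' E v; pose D u : R^o := L u - L' u.
have Dl : linear D.
  by move=> a u w; rewrite /D Ll Ll' scalerBr opprD addrACA.
pose lD := GRing.isLinear.Build _ _ _ _ D Dl.
pose D' : {linear 'rV[R]_n -> R^o} := HB.pack D lD.
have [/andP[/eqP full _] _] := A_basis.
have : v \in (lker (linfun D')).
  have : (<<[seq A i | i <- enum 'I_n]>> <= lker (linfun D'))%VS.
    apply/span_subvP => _ /mapP[i _ ->]; rewrite memv_ker lfunE /= /D E subrr //.
  by rewrite full => /subvP; apply; exact: memvf.
by rewrite memv_ker lfunE /= /D subr_eq0 => /eqP.
Qed.

Lemma linear_sum_basis (W : lmodType R) (L : 'rV[R]_n -> W) (c : 'I_n -> R)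
    (B : 'I_n -> 'rV[R]_n) :
  linear L -> L (\sum_i c i *: B i) = \sum_i c i *: L (B i).
Proof.
move=> Ll; pose lL := GRing.isLinear.Build _ _ _ _ L Ll.
pose L' : {linear 'rV[R]_n -> W} := HB.pack L lL.
rewrite -[L]/(L' : _ -> _) linear_sum; apply: eq_bigr => i _; exact: linearZ.
Qed.

Lemma ip_basis_sum (c : 'I_n -> R) j : ip (\sum_i c i *: A i) (A j) = c j.
Proof.
have [_ ortho] := A_basis.
rewrite [LHS](linear_sum_basis _ _ _ _ (ip_linear (A j))) (bigD1 j) //=.
rewrite ortho eqxx big1 ?addr0 ?[_ *: _]mulr1 // => i ij.
by rewrite ortho (negPf ij) [_ *: _]mulr0.
Qed.

Lemma rieszE xi : riesz g xi = \sum_i coapp xi (A i) *: A i.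
Proof.
set X0 := RHS.
have X0P Y : coapp xi Y = ip X0 Y.
  apply: linear_basis_ext => [||i]; first exact: coapp_linear.
    exact: ip_linearr.
  by rewrite ip_basis_sum.
(* The witness [X0] excludes the default value of [xget]; positivity of the inner product then
   identifies the chosen vector with [X0]. *)
rewrite /riesz; case: xgetP => [X _ XP|/(_ X0)]; last by case/(_ X0P).
have D0 : X - X0 = 0.
  apply/eqP/negPn/negP => /(metric_pos g_metric 1%g).
  rewrite (linear_subE _ _ _ _ (ip_linear _)) -XP -X0P subrr ltxx //.
by apply/eqP; rewrite -subr_eq0 D0.
Qed.

Lemma rieszP xi Y : coapp xi Y = ip (riesz g xi) Y.
Proof.
rewrite rieszE; apply: linear_basis_ext => [||i]; first exact: coapp_linear.
  exact: ip_linearr.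
by rewrite ip_basis_sum.
Qed.

Lemma riesz_linear : linear (riesz g).
Proof.
move=> a u v; rewrite !rieszE scaler_sumr -big_split; apply: eq_bigr => i _ /=.
by rewrite [coapp (_ + _) _]coapp_linearl scalerDl scalerA.
Qed.

Lemma riesz_covec X : riesz g (covec (ip X)) = X.
Proof.
pose lX := GRing.isLinear.Build _ _ _ _ (ip X : 'rV[R]_n -> R^o) (ip_linearr X).
pose X' : {linear 'rV[R]_n -> R^o} := HB.pack (ip X : 'rV[R]_n -> R^o) lX.
apply/eqP; rewrite -subr_eq0; apply/eqP/eqP/negPn/negP.
move=> /(metric_pos g_metric 1%g); rewrite (linear_subE _ _ _ _ (ip_linear _)) -rieszP.
by rewrite (covecK X') subrr ltxx.
Qed.

End OrthonormalBasis.

(** * Independence of the functions l_j *)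

Section Projections.
Context {R : realType} {E F : normedModType R}.

Lemma differentiable_fst (x : E * F) : differentiable (@fst E F) x.
Proof.
have fl : linear (@fst E F) by move=> a [u1 u2] [v1 v2].
pose l := GRing.isLinear.Build _ _ _ _ (@fst E F) fl.
pose L : {linear (E * F)%type -> E} := HB.pack (@fst E F) l.
by apply: (@linear_differentiable _ _ _ L) => y; exact: cvg_fst.
Qed.

Lemma differentiable_snd (x : E * F) : differentiable (@snd E F) x.
Proof.
have fl : linear (@snd E F) by move=> a [u1 u2] [v1 v2].
pose l := GRing.isLinear.Build _ _ _ _ (@snd E F) fl.
pose L : {linear (E * F)%type -> F} := HB.pack (@snd E F) l.
by apply: (@linear_differentiable _ _ _ L) => y; exact: cvg_snd.
Qed.

End Projections.

Lemma linear_kerZ {R : pzRingType} {U W : lmodType R} (f : U -> W) :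
  linear f -> forall k u, f u = 0 -> f (k *: u) = 0.
Proof.
move=> fl k u fu; have f0 : f 0 = 0 by rewrite -(subrr 0) linear_subE // subrr.
by rewrite -[k *: u]addr0 fl fu f0 scaler0 addr0.
Qed.

(** The line spanned by a central vector is an ideal whose first derived algebra is zero. *)
Lemma semisimple_center {R : realType} {n : nat} (G : lieGroupType R n) :
  semisimple G -> forall W, (forall Z, lie_bracket G Z W = 0) -> W = 0.
Proof.
move=> ss W cW.
have br0 Y Z : Z \in <[W]>%VS -> lie_bracket G Y Z = 0.
  by move=> /vlineP[k ->]; exact: (linear_kerZ _ (lie_bracket_linear G Y) _ _ (cW Y)).
have line0 : <[W]>%VS = 0%VS.
  apply: ss => [Y Z /br0 ->|]; first exact: mem0v.
  exists 1%N; apply/eqP; rewrite -subv0; apply/span_subvP => v.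
  by move=> /allpairsP[[Y Z] [/= _ /vbasis_mem /br0 ->]] ->; exact: mem0v.
by apply/eqP; rewrite -memv0 -line0 memv_line.
Qed.

Section Independence.
Context {R : realType} {n : nat} (G : lieGroupType R n).
Context (g : G -> 'rV[R]_n -> 'rV[R]_n -> R) (A : 'I_n -> 'rV[R]_n).
Context (g_biinv : biinvariant_metric g) (A_basis : orthonormal_basis g A).
Local Notation ip := (g 1%g).
(* A variable, so that unification does not unfold the bracket to limits. *)
Context (br : 'rV[R]_n -> 'rV[R]_n -> 'rV[R]_n) (br_def : br = lie_bracket G).
Local Notation E := ('cV[R]_n * 'rV[R]_n * 'cV[R]_n)%type.

Let g_metric : riemannian_metric g.
Proof. by case: g_biinv. Qed.

Let br_linear Y : linear (br Y).
Proof. by rewrite br_def; exact: lie_bracket_linear. Qed.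

Let brC Y Z : br Y Z = - br Z Y.
Proof. by rewrite br_def; exact: lie_bracketC. Qed.

Let br_linearl Z : linear (br^~ Z).
Proof. exact: br_linearl. Qed.

Let br_skew X Y Z : ip (br X Y) Z = - ip Y (br X Z).
Proof. by rewrite br_def; exact: lie_bracket_skew. Qed.

Let coappD (xi : 'cV[R]_n) h u v : coapp xi (h *: u + v) = h * coapp xi u + coapp xi v.
Proof. exact: coapp_linear. Qed.

Let coappDl (xi xi' : 'cV[R]_n) h Y :
  coapp (h *: xi + xi') Y = h * coapp xi Y + coapp xi' Y.
Proof. exact: coapp_linearl. Qed.

Lemma ell_lift i theta Y xi : ell g A (lift ord0 i) (theta, Y, xi) =
  coapp theta (A i) + coapp xi (br Y (A i)).
Proof.
rewrite /ell liftK -{1}[theta]scale1r coappDl mul1r; congr (_ + _).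
rewrite /coad /lie_ad -br_def.
have fl : linear (coapp xi \o br Y : 'rV[R]_n -> R^o).
  by move=> a u v; rewrite /= br_linear; exact: coapp_linear.
pose l := GRing.isLinear.Build _ _ _ _ (coapp xi \o br Y : 'rV[R]_n -> R^o) fl.
pose f : {linear 'rV[R]_n -> R^o} := HB.pack (coapp xi \o br Y : 'rV[R]_n -> R^o) l.
exact: (covecK f).
Qed.

Lemma ell_ord0 theta Y xi : ell g A ord0 (theta, Y, xi) =
  coapp theta Y + 2^-1 * coapp xi (riesz g xi).
Proof. by rewrite /ell unlift_none. Qed.

Let dtheta (x : E) : differentiable (fun p : E => p.1.1) x.
Proof.
apply: (@differentiable_comp _ _ _ _ fst fst); exact: differentiable_fst.
Qed.

Let dY (x : E) : differentiable (fun p : E => p.1.2) x.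
Proof.
apply: (@differentiable_comp _ _ _ _ fst snd);
  [exact: differentiable_fst|exact: differentiable_snd].
Qed.

Let dxi (x : E) : differentiable (fun p : E => p.2) x.
Proof. exact: differentiable_snd. Qed.

Let dX (x : E) : differentiable (fun p : E => riesz g p.2) x.
Proof.
have -> : (fun p : E => riesz g p.2) =
    \sum_(i < n) (fun p : E => (coapp p.2 (A i) : R) *: A i).
  by apply/funext => p; rewrite fct_sumE (rieszE G g A).
apply: differentiable_sum => i; apply: differentiableZl.
by apply: (differentiable_coapp n (fun=> A i) (fun p : E => p.2)).
Qed.

Lemma differentiable_ell j (x : E) : differentiable (ell g A j) x.
Proof.
case: (unliftP ord0 j) => [i ->|->].
  have -> : ell g A (lift ord0 i) =
      (fun p : E => coapp p.1.1 (A i) : R^o) +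
      (fun p : E => coapp p.2 (br p.1.2 (A i)) : R^o).
    by apply/funext => -[[theta Y] xi]; rewrite ell_lift.
  apply: differentiableD.
    exact: (differentiable_coapp n (fun=> A i) (fun p : E => p.1.1)).
  apply: (differentiable_coapp n (fun p : E => br p.1.2 (A i)) (fun p : E => p.2)) => //.
  by apply: (differentiable_row_linear n _ (br^~ (A i))).
have -> : ell g A ord0 = (fun p : E => coapp p.1.1 p.1.2 : R^o) +
    2^-1 *: (fun p : E => coapp p.2 (riesz g p.2) : R^o).
  by apply/funext => -[[theta Y] xi]; rewrite ell_ord0.
apply: differentiableD.
  exact: (differentiable_coapp n (fun p : E => p.1.2) (fun p : E => p.1.1)).
apply: differentiableZ.
exact: (differentiable_coapp n (fun p : E => riesz g p.2) (fun p : E => p.2)).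
Qed.

Lemma diff_ell_ord0_Y theta Y xi Z :
  'd (ell g A ord0) (theta, Y, xi) ((0, Z, 0) : E) = coapp theta Z.
Proof.
rewrite -deriveE; last exact: differentiable_ell.
apply: (derive_quadratic _ _ _ _ 0) => h.
rewrite -[h *: _ + _]/((h *: 0 + theta, h *: Z + Y, h *: 0 + xi) : E).
rewrite !scaler0 !add0r !ell_ord0 coappD.
move: (coapp theta Z) (coapp theta Y) (coapp xi _) => a b c; ring.
Qed.

Lemma diff_ell_lift_Y i theta Y xi Z :
  'd (ell g A (lift ord0 i)) (theta, Y, xi) ((0, Z, 0) : E) = coapp xi (br Z (A i)).
Proof.
rewrite -deriveE; last exact: differentiable_ell.
apply: (derive_quadratic _ _ _ _ 0) => h.
rewrite -[h *: _ + _]/((h *: 0 + theta, h *: Z + Y, h *: 0 + xi) : E).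
rewrite !scaler0 !add0r !ell_lift br_linearl coappD.
move: (coapp theta _) (coapp xi _) (coapp xi _) => a b c; ring.
Qed.

Lemma diff_ell_ord0_xi theta Y xi zeta :
  'd (ell g A ord0) (theta, Y, xi) ((0, 0, zeta) : E) = coapp zeta (riesz g xi).
Proof.
rewrite -deriveE; last exact: differentiable_ell.
apply: (derive_quadratic _ _ _ _ (2^-1 * coapp zeta (riesz g zeta))) => h.
rewrite -[h *: _ + _]/((h *: 0 + theta, h *: 0 + Y, h *: zeta + xi) : E).
rewrite !scaler0 !add0r !ell_ord0 (riesz_linear G g A) // coappD !coappDl.
(* By symmetry of the metric the two cross terms agree, and their sum cancels the factor 1/2. *)
have -> : coapp xi (riesz g zeta) = coapp zeta (riesz g xi).
  by rewrite !(rieszP G g A g_metric A_basis) (Defs.metric_sym g_metric).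
move: (coapp zeta _) (coapp zeta _) (coapp xi _) (coapp theta _) => a b c d; by field.
Qed.

Lemma diff_ell_lift_xi i theta Y xi zeta :
  'd (ell g A (lift ord0 i)) (theta, Y, xi) ((0, 0, zeta) : E) =
  coapp zeta (br Y (A i)).
Proof.
rewrite -deriveE; last exact: differentiable_ell.
apply: (derive_quadratic _ _ _ _ 0) => h.
rewrite -[h *: _ + _]/((h *: 0 + theta, h *: 0 + Y, h *: zeta + xi) : E).
rewrite !scaler0 !add0r !ell_lift coappDl.
move: (coapp theta _) (coapp zeta _) (coapp xi _) => a b c; ring.
Qed.

(** The witness curve is a straight line with [theta] constant, so it never leaves the product. *)
Lemma tangent_vectors_vertical (S : set 'cV[R]_n) theta Y xi Z zeta : S theta ->
  tangent_vectors (S `*` [set: 'rV[R]_n] `*` [set: 'cV[R]_n])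
    (theta, Y, xi) ((0, Z, zeta) : E).
Proof.
move=> St; exists (fun t => (theta, Y, xi) + t *: ((0, Z, zeta) : E)); split.
- exact: smooth_on_line.
- by move=> t; split => //; split => //=; rewrite scaler0 addr0.
- by rewrite scale0r addr0.
- rewrite -[RHS](derive_id ((theta, Y, xi) : E)).
  by apply: derive_along => h; rewrite addr0 [h *: 1]mulr1 addrC.
Qed.

Lemma ell_independent_at (S : set 'cV[R]_n) theta Y xi (a : 'I_n.+1 -> R) :
  S theta -> coapp xi Y != 0 -> row_free (ad_pair_mx br Y (riesz g xi)) ->
  (forall v, tangent_vectors (S `*` [set: 'rV[R]_n] `*` [set: 'cV[R]_n])
     (theta, Y, xi) v -> \sum_j a j * 'd (ell g A j) (theta, Y, xi) v = 0) ->
  forall j, a j = 0.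
Proof.
move=> St xiY rf H.
pose W := \sum_i a (lift ord0 i) *: A i.
have sumW (L : 'rV[R]_n -> R^o) : linear L ->
    \sum_i a (lift ord0 i) * L (A i) = L W.
  by move=> Ll; rewrite (linear_sum_basis _ _ _ _ Ll).
have HY Z : a ord0 * coapp theta Z + coapp xi (br Z W) = 0.
  rewrite -(H _ (tangent_vectors_vertical S theta Y xi Z 0 St)) big_ord_recl.
  rewrite diff_ell_ord0_Y -(sumW (fun B => coapp xi (br Z B))).
    by congr (_ + _); apply: eq_bigr => i _; rewrite diff_ell_lift_Y.
  by move=> c u v; rewrite br_linear; exact: coapp_linear.
have Hxi : a ord0 *: riesz g xi + br Y W = 0.
  have Hz zeta : coapp zeta (a ord0 *: riesz g xi + br Y W) = 0.
    rewrite coappD -(H _ (tangent_vectors_vertical S theta Y xi 0 zeta St)) big_ord_recl.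
    rewrite diff_ell_ord0_xi -(sumW (fun B => coapp zeta (br Y B))).
      by congr (_ + _); apply: eq_bigr => i _; rewrite diff_ell_lift_xi.
    by move=> c u v; rewrite br_linear; exact: coapp_linear.
  apply/rowP => i; have := Hz (delta_mx i 0).
  rewrite /coapp mxE (bigD1 i) //= big1 ?addr0 => [|k ki].
    by rewrite [X in _ * X]mxE !eqxx mulr1 => ->; rewrite mxE.
  by rewrite [X in _ * X]mxE (negPf ki) mulr0.
have ipE := Defs.metric_linear g_metric 1%g.
have ip0 u : ip 0 u = 0.
  by have := ipE (-1) 0 0 u; rewrite scaler0 addr0 mulN1r addNr.
have br_self : br Y Y = 0 by rewrite br_def /lie_bracket subrr.
(* Pairing [Hxi] with [Y] leaves [a ord0 * coapp xi Y], since
   [ip (br Y W) Y = - ip W (br Y Y) = 0]. *)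
have a0 : a ord0 = 0.
  have := congr1 (ip^~ Y) Hxi; rewrite /= ip0 ipE -(rieszP G g A g_metric A_basis).
  rewrite br_skew br_self.
  rewrite (Defs.metric_sym g_metric) ip0 oppr0 addr0 => /eqP.
  by rewrite mulf_eq0 (negPf xiY) orbF => /eqP.
move: Hxi; rewrite a0 scale0r add0r => YW.
have XW : br (riesz g xi) W = 0.
  (* With [Z] this bracket, its squared norm is [coapp xi (br Z W)] by invariance, which [HY]
     annihilates. *)
  have skew0 : br W (riesz g xi) = 0.
    apply/eqP/negPn/negP => /(Defs.metric_pos g_metric 1%g).
    rewrite br_skew -(rieszP G g A g_metric A_basis).
    rewrite brC; set Z := br W _.
    have := HY Z; rewrite a0 mul0r add0r => xiZ.
    have -> : coapp xi (- br Z W) = - coapp xi (br Z W) by rewrite /coapp mulNmx mxE.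
    by rewrite xiZ !oppr0 ltxx.
  by rewrite brC skew0 oppr0.
have W0 : W = 0.
  move: rf; move/(row_free_ad_pair br br_linear); exact.
move=> j; case: (unliftP ord0 j) => [i ->|->] //.
(* Each remaining coefficient is the inner product of [W] with [A i]. *)
have := ip_basis_sum G g A g_metric A_basis (fun i => a (lift ord0 i)) i.
by rewrite -/W W0 ip0.
Qed.

Lemma ad_pair_mx_mulE (B : 'M[R]_(n + n, n)) Y X i j :
  (ad_pair_mx br Y X *m B) i j =
  coapp (col j (usubmx B)) (br Y (delta_mx 0 i)) +
  coapp (col j (dsubmx B)) (br X (delta_mx 0 i)).
Proof.
rewrite -{1}(vsubmxK B) mul_row_col mxE; congr (_ + _);
  by rewrite /coapp !mxE; apply: eq_bigr => k _; rewrite !mxE.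
Qed.

(** The defining function is differentiable, hence continuous. On the line from any point towards
    [Y0] and the covector of [X0], with [theta] fixed, it is a polynomial nonzero at [t = 1], so it
    has nonroots arbitrarily close to [t = 0]. *)
Lemma open_dense_locus (S : set 'cV[R]_n) (B : 'M[R]_(n + n, n)) Y0 X0 :
  ip X0 Y0 != 0 -> ad_pair_mx br Y0 X0 *m B = 1%:M ->
  let M := S `*` [set: 'rV[R]_n] `*` [set: 'cV[R]_n] in
  open_dense_in M (M `&` [set p : E | coapp p.2 p.1.2 *
    \det (ad_pair_mx br p.1.2 (riesz g p.2) *m B) != 0]).
Proof.
move=> XY0 B1 M; set O := [set p | _]; split.
  exists O => //; rewrite (_ : O = (fun p : E => coapp p.2 p.1.2 *
    \det (ad_pair_mx br p.1.2 (riesz g p.2) *m B) : R^o) @^-1` [set~ 0]); last first.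
    by apply/seteqP; split => p /= /eqP.
  apply: open_comp; last first.
    apply/closed_openC/accessible_closed_set1/hausdorff_accessible.
    exact: norm_hausdorff.
  move=> p _; apply: differentiable_continuous.
  apply: (@differentiableM _ _ (fun p : E => coapp p.2 p.1.2)).
    exact: (differentiable_coapp n (fun p : E => p.1.2) (fun p : E => p.2)).
  apply: differentiable_det => i j.
  have -> : (fun p : E => (ad_pair_mx br p.1.2 (riesz g p.2) *m B) i j : R) =
      (fun p : E => coapp (col j (usubmx B)) (br p.1.2 (delta_mx 0 i)) : R^o) +
      (fun p : E => coapp (col j (dsubmx B)) (br (riesz g p.2) (delta_mx 0 i)) : R^o).
    by apply/funext => q; rewrite ad_pair_mx_mulE.
  apply: differentiableD.
    apply: (differentiable_coapp n (fun p : E => br p.1.2 (delta_mx 0 i)) (fun=> col j (usubmx B))) => //.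
    by apply: (differentiable_row_linear n _ (br^~ (delta_mx 0 i))).
  apply: (differentiable_coapp n (fun p : E => br (riesz g p.2) (delta_mx 0 i)) (fun=> col j (dsubmx B))) => //.
  by apply: (differentiable_row_linear n _ (br^~ (delta_mx 0 i))).
move=> [[theta Y] xi] Mp U /= nU.
pose xi0 := covec (ip X0).
(* The first component is zero so that the line stays over the same point of [S]. *)
pose v : E := (0, Y0 - Y, xi0 - xi).
have [d d0 dU] : exists2 d : R, 0 < d & forall t, 0 < t -> t < d ->
    U ((theta, Y, xi) + t *: v).
  have : {for (0 : R^o), continuous (fun t : R^o => (theta, Y, xi) + t *: v)}.
    apply: differentiable_continuous.
    exact: (smooth_on_differentiable _ _ _ _ (smooth_on_line setT (theta, Y, xi) v) I).
  have E0 : (theta, Y, xi) + (0 : R) *: v = (theta, Y, xi) by rewrite scale0r addr0.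
  rewrite -E0 in nU; move=> /(_ U nU) /nbhs_ballP[d /= d0 dP].
  exists d => // t t0 td; apply: dP; rewrite -ball_normE /ball_ /= sub0r normrN.
  by rewrite gtr0_norm.
have [p1 p1E] : exists p : {poly R}, forall t, p.[t] =
    coapp (xi + t *: (xi0 - xi)) (Y + t *: (Y0 - Y)).
  exists ((coapp xi Y)%:P + (coapp xi (Y0 - Y) + coapp (xi0 - xi) Y) *: 'X
    + coapp (xi0 - xi) (Y0 - Y) *: 'X^2) => t.
  rewrite (addrC xi) (addrC Y) coappDl !coappD.
  move: (coapp _ _) (coapp _ _) (coapp _ _) (coapp _ _) => a b c e.
  by rewrite !hornerD !hornerZ hornerC hornerX hornerXn; ring.
have [p2 p2E] := det_pencil_horner _ (ad_pair_mx br Y (riesz g xi) *m B)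
  (ad_pair_mx br (Y0 - Y) (X0 - riesz g xi) *m B).
have rlin := riesz_linear G g A g_metric A_basis.
have rE t : riesz g (xi + t *: (xi0 - xi)) = riesz g xi + t *: (X0 - riesz g xi).
  rewrite addrC rlin (linear_subE _ _ _ _ rlin) addrC.
  by rewrite (riesz_covec G g A g_metric A_basis).
have p2E' t : p2.[t] = \det (ad_pair_mx br (Y + t *: (Y0 - Y))
    (riesz g (xi + t *: (xi0 - xi))) *m B).
  by rewrite p2E rE ad_pair_mxD // mulmxDl scalemxAl.
(* At [t = 1] the factors are [ip X0 Y0] and [\det 1%:M]. *)
have pn0 : p1 * p2 != 0.
  apply/eqP => p0; have := congr1 (fun p => p.[1]) p0.
  rewrite hornerM p1E p2E' !scale1r !(addrC _ (_ - _)) !subrK horner0.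
  rewrite (riesz_covec G g A g_metric A_basis) B1 det1 mulr1.
  rewrite (rieszP G g A g_metric A_basis) (riesz_covec G g A g_metric A_basis).
  by move/eqP; rewrite (negPf XY0).
have [t [t0 td tn]] := poly_nonroot_small _ _ pn0 d0.
exists ((theta, Y, xi) + t *: v); split; last exact: dU.
split.
  by move: Mp => [[St _] _]; split => //; split => //=; rewrite scaler0 addr0.
by rewrite hornerM p1E p2E' in tn.
Qed.

End Independence.

Theorem lemma6 (R : realType) (n : nat) (G : lieGroupType R n)
    (g : G -> 'rV[R]_n -> 'rV[R]_n -> R) (A : 'I_n -> 'rV[R]_n) (eta : 'cV[R]_n) :
  (0 < n)%N ->
  compact [set: G] -> connected [set: G] ->
  biinvariant_metric g -> orthonormal_basis g A ->
  semisimple G ->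
  let M : set ('cV[R]_n * 'rV[R]_n * 'cV[R]_n) :=
    coadjoint_orbit G eta `*` [set: 'rV[R]_n] `*` [set: 'cV[R]_n] in
  exists U : set ('cV[R]_n * 'rV[R]_n * 'cV[R]_n),
    open_dense_in M U /\ functionally_independent_on M (ell g A) U.
Proof.
move=> n0 _ _ g_biinv A_basis ss M.
have [g_metric _ _] := g_biinv.
have [Y0 [X0 [YX XY]]] := exists_nonorthogonal_trivial_centralizer _ _
  (lie_bracket_linear G) (lie_bracketC G) (lie_bracket_jacobi G)
  (Defs.metric_linear g_metric 1%g) (Defs.metric_sym g_metric 1%g)
  (Defs.metric_pos g_metric 1%g) (lie_bracket_skew G g g_biinv)
  (semisimple_center G ss) n0.
have /row_freeP[B B1] := YX.
have od := open_dense_locus G g A g_biinv A_basis _ erefl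
  (coadjoint_orbit G eta) B Y0 X0 XY B1.
eexists; split; first exact: od.
move=> [[theta Y] xi] [[[St _] _] /= ndet] a H j.
move: ndet; rewrite mulf_eq0 negb_or => /andP[xiY dn].
apply: (ell_independent_at G g A g_biinv A_basis _ erefl _ theta Y xi a St xiY _ H).
(* The nonzero determinant makes the product with [B] invertible, which yields a right inverse of
   the pair matrix at this point. *)
apply/row_freeP; exists (B *m invmx (ad_pair_mx (lie_bracket G) Y (riesz g xi) *m B)).
by rewrite mulmxA mulmxV // unitmxE unitfE.
Qed.
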